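(* Consider the problem $$(\ast)\qquad \max_{\delta\in\Delta}\int_{\Theta_1}g(p(\theta;\delta))\,\Lambda_1(d\theta)\quad\text{subject to } p(\theta_0;\delta)\le\alpha .$$ Suppose that (A1) $\lim_{n\to\infty}\int_{\mathbb{Y}}|f_{\theta_n}(y)-f_\theta(y)|\,\mu(dy)=0$ whenever $\theta_n,\theta\in\Theta$, $\theta_n\to\theta$, and $\mu_\theta,\mu_{\theta'}$ are mutually absolutely continuous for all $\theta,\theta'\in\Theta$; and (A2) $g$ is continuously differentiable on $(0,1)$ and continuous at $0$ and $1$. (i) If the rule $\bar\delta_0\equiv 0$ is not an optimal solution to $(\ast)$, then there exists an optimal rule $\delta^*\in\Delta$ for $(\ast)$ such that, for some constant $\kappa\in\mathbb{R}$ and a measurable function $\gamma:\mathbb{Y}\to[0,1]$, for each $y\in\mathbb{Y}$, $$\delta^*(y)=\begin{cases}1,&H(y)>\kappa f_{\theta_0}(y)\\ \gamma(y),&H(y)=\kappa f_{\theta_0}(y)\\ 0,&H(y)<\kappa f_{\theta_0}(y),\end{cases}\qquad\text{where } H(y):=\int_{\Theta_1}g'(p(\theta;\delta^* ))f_\theta(y)\,\Lambda_1(d\theta).$$ (ii) If $\bar\delta_0$ is not an optimal solution to $(\ast)$, then any optimal rule $\delta^*\in\Delta$ for $(\ast)$ must take the form displayed in (i) (with $H$ defined from this $\delta^*$, for some $\kappa\in\mathbb{R}$ and measurable $\gamma:\mathbb{Y}\to[0,1]$) for $\mu$-almost every $y$. (iii) If, in addition to (A1) and (A2), $g'(t)>0$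 for all $0<t<1$, then $\bar\delta_0$ is not an optimal solution to $(\ast)$, and for any optimal rule $\delta^*\in\Delta$ for $(\ast)$ we have $p(\theta_0;\delta^* )=\alpha$.
   Context: Let $\Theta\subset\mathbb{R}^{d_1}$ ($d_1\ge1$) be compact, $\theta_0\in\Theta$, and $\Theta_1:=\Theta\setminus\{\theta_0\}$, assumed non-empty. Let $\mathbb{Y}\subset\mathbb{R}^{d_2}$ ($d_2\ge1$) be the observation space, $\mu$ a $\sigma$-finite measure on $\mathbb{Y}$, and for each $\theta\in\Theta$ let $f_\theta$ be a probability density function with respect to $\mu$; $(\theta,y)\mapsto f_\theta(y)$ is jointly measurable. Let $\mu_\theta$ be the probability measure with $d\mu_\theta/d\mu=f_\theta$. $\Delta$ is the set of all randomized decision rules, i.e. measurable functions $\delta:\mathbb{Y}\to[0,1]$, and $p(\theta;\delta)=\int_{\mathbb{Y}}\delta(y)f_\theta(y)\,\mu(dy)$. Here $\alpha\in(0,1)$, $g:[0,1]\to\mathbb{R}$ is a measurable function, and $\Lambda_1$ is a probability measure on $\Theta_1$. $\bar\delta_0$ denotes the rule with $\bar\delta_0(y)=0$ for all $y\in\mathbb{Y}$. (When $\bar\delta_0$ is not optimal, every optimal rule $\delta^*$ satisfies $p(\theta;\delta^* )\in(0,1)$ for all $\theta\in\Theta$, so $g'(p(\theta;\delta^* ))$ is well defined.) *)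

(* Defs.v *)
From HB Require Import structures.
From mathcomp Require Import all_boot all_order all_algebra.
From mathcomp Require Import all_classical all_reals all_analysis.
Set Implicit Arguments.
Unset Strict Implicit.
Unset Printing Implicit Defensive.
Import Order.TTheory GRing.Theory Num.Theory.
Import numFieldNormedType.Exports.

Local Open Scope classical_set_scope.
Local Open Scope ring_scope.

Section BorelSubspace.
Context (R : realType) (n : nat) (A : set 'rV[R]_n).

(* [subspace_of hA] is the type of the points of [A] with the subspace
   topology.  The proof [hA] that [A] is nonempty is there only because
   a [measurableType] must be pointed. *)
Definition subspace_of (hA : A !=set0) : Type := set_type A.

HB.instance Definition _ hA := Topological.copy (subspace_of hA) (set_type A).
HB.instance Definition _ hA := isPointed.Build (subspace_of hA)
  (exist (fun x => x \in A) (sval (cid hA)) (mem_set (svalP (cid hA)))).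

(* [A] with the Borel sigma-algebra of its subspace topology; [A] itself need
   not be a Borel subset of the ambient space. *)
Definition borel_of (hA : A !=set0) : Type :=
  g_sigma_algebraType (@open (subspace_of hA)).

Definition borel_val (hA : A !=set0) (x : borel_of hA) : 'rV[R]_n :=
  @set_val _ A x.

End BorelSubspace.

Section Densities.
Context (R : realType) (d : measure_display) (Y : measurableType d).
Variable mu : {measure set Y -> \bar R}.

Definition is_density (h : Y -> R) : Prop :=
  [/\ measurable_fun setT h, (forall y, 0 <= h y) &
      (\int[mu]_y (h y)%:E = 1)%E].

(* The set function with density [h] with respect to [mu]. *)
Definition measure_of_density (h : Y -> R) : set Y -> \bar R :=
  fun B => (\int[mu]_(y in B) (h y)%:E)%E.

End Densities.

Section DecisionProblem.
Context (R : realType) (d1 : nat).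
Context (d : measure_display) (Y : measurableType d).
Variables (mu : {measure set Y -> \bar R}) (f : 'rV[R]_d1 -> Y -> R).

Definition decision_rule (delta : Y -> R) : Prop :=
  measurable_fun setT delta /\ forall y, 0 <= delta y <= 1.

Definition power (theta : 'rV[R]_d1) (delta : Y -> R) : R :=
  \int[mu]_y (delta y * f theta y).

Variables (theta0 : 'rV[R]_d1) (alpha : R) (g : R -> R).
Context (Theta1 : set 'rV[R]_d1) (hTheta1 : Theta1 !=set0).
Variable Lambda1 : probability (borel_of hTheta1) R.

Definition objective (delta : Y -> R) : R :=
  \int[Lambda1]_t g (power (borel_val t) delta).

Definition feasible (delta : Y -> R) : Prop :=
  decision_rule delta /\ power theta0 delta <= alpha.

Definition optimal (delta : Y -> R) : Prop :=
  feasible delta /\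
  forall delta', feasible delta' -> objective delta' <= objective delta.

(* Extended-real valued: the integral may be infinite for exceptional [y]
   (if both the positive and the negative parts have infinite integral, its
   value is -oo by the library's convention). *)
Definition weighted_density (delta : Y -> R) (y : Y) : \bar R :=
  (\int[Lambda1]_t
     (derive1 g (power (borel_val t) delta) * f (borel_val t) y)%:E)%E.

Definition neyman_pearson_at (delta : Y -> R) (kappa : R) (gamma : Y -> R)
    (y : Y) : Prop :=
  [/\ ((kappa * f theta0 y)%:E < weighted_density delta y)%E -> delta y = 1,
      weighted_density delta y = (kappa * f theta0 y)%:E ->
        delta y = gamma y &
      (weighted_density delta y < (kappa * f theta0 y)%:E)%E -> delta y = 0].

End DecisionProblem.

Definition L1_continuous_on (R : realType) (d1 : nat) (Theta : set 'rV[R]_d1)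
    (d : measure_display) (Y : measurableType d)
    (mu : {measure set Y -> \bar R}) (f : 'rV[R]_d1 -> Y -> R) : Prop :=
  forall (u : nat -> 'rV[R]_d1) (theta : 'rV[R]_d1),
    (forall n, Theta (u n)) -> Theta theta -> u n @[n --> \oo] --> theta ->
    (\int[mu]_y `|f (u n) y - f theta y|%:E)%E @[n --> \oo] --> 0%E.

Definition mutually_abs_continuous_on (R : realType) (d1 : nat)
    (Theta : set 'rV[R]_d1) (d : measure_display) (Y : measurableType d)
    (mu : {measure set Y -> \bar R}) (f : 'rV[R]_d1 -> Y -> R) : Prop :=
  forall theta theta', Theta theta -> Theta theta' ->
    measure_of_density mu (f theta) `<< measure_of_density mu (f theta').

Definition C1_inside_continuous_at_ends (R : realType) (g : R -> R) : Prop :=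
  [/\ forall t, 0 < t < 1 -> derivable g t 1,
      forall t, 0 < t < 1 -> {for t, continuous (derive1 g)},
      g t @[t --> 0^'+] --> g 0 &
      g t @[t --> 1^'-] --> g 1].

(* Main.v *)
Require Import Defs.
From mathcomp Require Import all_boot all_order all_algebra.
From mathcomp Require Import all_classical all_reals all_analysis.
From mathcomp Require Import measurable_realfun ring lra.
Import Order.TTheory GRing.Theory Num.Theory.
Import numFieldNormedType.Exports.
Set Implicit Arguments.
Unset Strict Implicit.
Unset Printing Implicit Defensive.

Local Open Scope classical_set_scope.
Local Open Scope ring_scope.

(** A maximizing rule exists because the objective only sees a rule through
    its power function, and power functions converge along subsequences.
    Every density vanishes almost everywhere where [w := f theta0] does, so [w]
    is a reference weight for all of them.  A sequence of power functions
    clusters at some [c] on a countable dense set of parameters; the rules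
    whose powers are within [1/(n+1)] of [c] at the first [n+1] parameters form
    a decreasing sequence of convex sets, and elements of these sets that are
    almost minimal for the norm of L2([w] mu) form a fast Cauchy sequence, by
    the parallelogram identity.  Its almost-everywhere limit is a rule whose
    power is [c] ([rule_seq_weak_compact]).  L1-continuity of the densities
    extends the convergence of powers from the dense set to all of [Theta]
    ([rule_seq_power_compact]), and dominated convergence carries it to the
    objective ([optimal_exists]).

    If the zero rule is not optimal, the power of an optimal rule [delta] stays
    in a compact subinterval of ]0, 1[: by mutual absolute continuity a power
    equal to 0 or 1 at one parameter is so at all of them.  Moving from [delta]
    towards a feasible [delta'] and differentiating under the integral gives
    the first-order condition, and Fubini turns it into
    [\int delta' H <= \int delta H], where [H] is the weighted density of
    [delta] ([first_order_condition], [weighted_density_duality]).  So [delta]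
    maximizes a linear functional among the rules of its own size.  An exchange
    of equal [w]-mass between a set where [k w < H] and a set where [H < k w]
    would improve it; hence each level [k] lies above or below a threshold, and
    the infimum of the levels above it is the multiplier [kappa]
    ([neyman_pearson_threshold]).  Redefining [delta] on the exceptional null
    set changes no power, so [H] is unchanged and the form holds everywhere.

    If [g' > 0], then [g] is strictly increasing on [[0, 1]].  The constant rule
    [alpha] beats the zero rule, and as long as the size is below [alpha] a
    small step towards the rule 1 strictly increases every power. *)

(** * Integrals of real functions and decision rules *)

Section Prelim.
Context {R : realType} {d : measure_display} {Y : measurableType d}.
Variable mu : {measure set Y -> \bar R}.
Implicit Types h w : Y -> R.

Lemma measurable_set_lt h w : measurable_fun setT h -> measurable_fun setT w ->
  measurable [set y | h y < w y].
Proof.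
move=> mh mw; have := measurable_fun_ltr mh mw measurableT (Y := [set true]) I.
by rewrite setTI; congr measurable; apply/seteqP; split.
Qed.

Lemma integrable_bounded_mul {h w} (C : R) : measurable_fun setT h ->
  (forall y, `|h y| <= C) -> mu.-integrable setT (EFin \o w) ->
  mu.-integrable setT (EFin \o (fun y => h y * w y)).
Proof.
move=> mh hC iw; have mw := measurable_int mu iw.
apply: (le_integrable measurableT _ _ (integrableZl measurableT C iw)).
  by apply/measurable_EFinP/measurable_funM => //; exact/measurable_EFinP.
move=> y _ /=; rewrite lee_fin !normrM; apply: ler_wpM2r => //.
by rewrite (le_trans (hC y))// ler_norm.
Qed.

Lemma dominated_cvg_Rintegral (u : nat -> Y -> R) h w :
  (forall n, measurable_fun setT (u n)) -> measurable_fun setT h ->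
  {ae mu, forall y, u n y @[n --> \oo] --> h y} ->
  mu.-integrable setT (EFin \o w) -> (forall n y, `|u n y| <= w y) ->
  \int[mu]_y u n y @[n --> \oo] --> \int[mu]_y h y.
Proof.
move=> mu_ mh uh iw uw.
have [ih _ cvg] := @dominated_convergence _ _ _ mu _ measurableT
  (fun n y => (u n y)%:E) (EFin \o h) (EFin \o w)
  (fun n => (measurable_EFinP _ _).2 (mu_ n)) ((measurable_EFinP _ _).2 mh)
  ltac:(by apply: filterS uh => y uy _; apply: cvg_EFin => //; exact: nearW)
  iw ltac:(by apply: aeW => y n _; rewrite lee_fin uw).
by apply: fine_cvg; rewrite fineK//; exact: integrable_fin_num.
Qed.

(** Turns a failure on a non-null set into a strict inequality between
    integrals, as the exchange and improvement arguments require. *)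
Lemma Rintegral_gt0 h : mu.-integrable setT (EFin \o h) ->
  (forall y, 0 <= h y) -> ~ {ae mu, forall y, h y = 0} -> 0 < \int[mu]_y h y.
Proof.
move=> ih h0 hN0; rewrite lt0r Rintegral_ge0// andbT.
apply/eqP => Ih0; apply: hN0.
have : (\int[mu]_y (h y)%:E = 0)%E.
  by rewrite -[LHS]fineK ?integrable_fin_num// -[fine _]/(Rintegral _ _ _) Ih0.
move=> I0.
have : (\int[mu]_y `|(EFin \o h) y| = 0)%E.
  by rewrite -[RHS]I0; apply: eq_integral => y _; rewrite /= ger0_norm.
move/(ae_eq_integral_abs mu measurableT (measurable_int mu ih)).
by apply: filterS => y /(_ I) [].
Qed.

Lemma ae_eq_Rintegral h h' : measurable_fun setT h -> measurable_fun setT h' ->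
  {ae mu, forall y, h y = h' y} -> \int[mu]_y h y = \int[mu]_y h' y.
Proof.
move=> mh mh' hh'; congr fine; apply: ae_eq_integral => //.
- exact/measurable_EFinP.
- exact/measurable_EFinP.
- by apply: filterS hh' => y -> _.
Qed.

Lemma integrableZl_fun (c : R) h : mu.-integrable setT (EFin \o h) ->
  mu.-integrable setT (EFin \o (fun y => c * h y)).
Proof. by move=> ih; exact: (integrableZl measurableT c ih). Qed.

Lemma integrableD_fun h h' : mu.-integrable setT (EFin \o h) ->
  mu.-integrable setT (EFin \o h') ->
  mu.-integrable setT (EFin \o (fun y => h y + h' y)).
Proof. by move=> ih ih'; exact: (integrableD measurableT ih ih'). Qed.

Lemma integrableB_fun h h' : mu.-integrable setT (EFin \o h) ->
  mu.-integrable setT (EFin \o h') ->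
  mu.-integrable setT (EFin \o (fun y => h y - h' y)).
Proof. by move=> ih ih'; exact: (integrableB measurableT ih ih'). Qed.

Lemma integrable_rule_mul h w : decision_rule h ->
  mu.-integrable setT (EFin \o w) ->
  mu.-integrable setT (EFin \o (fun y => h y * w y)).
Proof.
move=> [mh h01]; apply: (integrable_bounded_mul (C := 1)) => // y.
by have /andP[? ?] := h01 y; rewrite ger0_norm.
Qed.

Lemma rule_segment h h' (s : R) : 0 <= s <= 1 ->
  decision_rule h -> decision_rule h' ->
  decision_rule (fun y => h y + s * (h' y - h y)).
Proof.
move=> s01 [mh h01] [mh' h'_01]; split.
  apply: measurable_funD => //; apply: measurable_funM => //.
  exact: measurable_funB.
by move=> y; have := h01 y; have := h'_01 y; nra.
Qed.

Lemma rule_cst (a : R) : 0 <= a <= 1 -> decision_rule (fun _ : Y => a).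
Proof. by move=> a01; split. Qed.

Lemma rule_mid h h' : decision_rule h -> decision_rule h' ->
  decision_rule (fun y => 2^-1 * (h y + h' y)).
Proof.
move=> [mh h01] [mh' h'01]; split.
  by apply: measurable_funM => //; exact: measurable_funD.
by move=> y; have := h01 y; have := h'01 y; lra.
Qed.

End Prelim.

(** * Almost norm-minimal rules in a decreasing sequence of convex sets *)

Section NearMinimalRules.
Context {R : realType} {d : measure_display} {Y : measurableType d}.
Variable mu : {measure set Y -> \bar R}.
Variable w : Y -> R.
Hypothesis w0 : forall y, 0 <= w y.
Hypothesis iw : mu.-integrable setT (EFin \o w).
Implicit Types (h : Y -> R) (k : nat -> Y -> R).

Let mw : measurable_fun setT w.
Proof. exact/measurable_EFinP/(measurable_int mu iw). Qed.

Lemma integrable_rule_sqr h : decision_rule h ->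
  mu.-integrable setT (EFin \o (fun y => h y ^+ 2 * w y)).
Proof.
move=> [mh h01]; apply: (integrable_bounded_mul (C := 1)) => //.
  exact: measurable_funX.
move=> y; have /andP[h0 h1] := h01 y.
by rewrite ger0_norm ?sqr_ge0// expr_le1.
Qed.

(** The midpoint of two almost norm-minimal elements of a convex set cannot
    have a much smaller norm than they have; through this identity the two
    elements must then be close. *)
Lemma parallelogram_sqr h h' : decision_rule h -> decision_rule h' ->
  \int[mu]_y ((h y - h' y) ^+ 2 * w y) =
  2 * \int[mu]_y (h y ^+ 2 * w y) + 2 * \int[mu]_y (h' y ^+ 2 * w y)
  - 4 * \int[mu]_y ((2^-1 * (h y + h' y)) ^+ 2 * w y).
Proof.
move=> rh rh'; have rm := rule_mid rh rh'.
have ih := integrable_rule_sqr rh; have ih' := integrable_rule_sqr rh'.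
have im := integrable_rule_sqr rm.
rewrite -!RintegralZl// -RintegralD//; last 2 first.
- exact: integrableZl_fun.
- exact: integrableZl_fun.
rewrite -RintegralB//; last 2 first.
- by apply: integrableD_fun => //; exact: integrableZl_fun.
- exact: integrableZl_fun.
by apply: eq_Rintegral => y _; field.
Qed.

(** The infima of the squared norms over the sets [C n] increase with [n] to a
    finite limit [s].  Elements whose squared norms are close to [s], taken from
    sets whose infima are close to [s], are close to each other by the
    parallelogram identity. *)
Lemma near_minimal_sequence (C : nat -> set (Y -> R)) :
  (forall n, C n !=set0) ->
  (forall m n, (m <= n)%N -> C n `<=` C m) ->
  (forall n h h', C n h -> C n h' -> C n (fun y => 2^-1 * (h y + h' y))) ->
  (forall n h, C n h -> decision_rule h) ->
  exists k, (forall n, C n (k n)) /\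
    forall n, \int[mu]_y ((k n.+1 y - k n y) ^+ 2 * w y) <= 4^-1 ^+ n.
Proof.
move=> C0 Cdecr Cmid Crule.
pose N h := \int[mu]_y (h y ^+ 2 * w y).
(* The supremum of [S] is the limit of the infima of [N] over the [C n]. *)
pose S := [set r | exists n, forall h, C n h -> r <= N h].
have S_sup : has_sup S.
  split; first by exists 0, 0%N => h _; apply: Rintegral_ge0 => y _;
    rewrite mulr_ge0// sqr_ge0.
  exists (\int[mu]_y w y) => r [n nr]; have [h Ch] := C0 n.
  apply: le_trans (nr h Ch) _.
  have rh := Crule _ _ Ch; apply: le_Rintegral => //.
    exact: integrable_rule_sqr.
  move=> y _; have /andP[h0' h1] := rh.2 y.
  by rewrite ler_piMl// expr_le1.
pose s := sup S.
(* Two squared norms within [e j] of [s], and a midpoint at least [s - e j],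
   make the squared distance at most [8 * e j]. *)
pose e j : R := 8^-1 * 4^-1 ^+ j.
have e0 j : 0 < e j by rewrite mulr_gt0// exprn_gt0.
have eS j : e j.+1 <= e j.
  by rewrite /e exprS; have := exprn_gt0 j (ltac:(lra) : 0 < 4^-1 :> R); lra.
have step j : exists h, exists m,
    [/\ (j <= m)%N, C m h, N h <= s + e j &
        forall h', C m h' -> s - e j <= N h'].
  have [r [n nr] rs] := sup_adherent (e0 j) S_sup.
  pose m := maxn n j.
  have [h [Ch hs]] : exists h, C m h /\ N h <= s + e j.
    apply: contrapT => /forallNP noh.
    have : S (s + e j).
      exists m => h Ch; rewrite leNgt; apply/negP => hs.
      by apply: (noh h); split => //; exact: ltW.
    by move/(ub_le_sup S_sup.2); rewrite -/s; have := e0 j; lra.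
  exists h, m; split => //; first exact: leq_maxr.
  by move=> h' Ch'; rewrite (le_trans (ltW rs))// nr//; apply: Cdecr Ch';
    exact: leq_maxl.
have [k /choice[m km]] := choice step.
exists k; split=> [n|n].
  by have [nm Cm _ _] := km n; exact: Cdecr Cm.
have [nm Ck Nk sk] := km n; have [nm' Ck' Nk' sk'] := km n.+1.
rewrite parallelogram_sqr; [|exact: Crule Ck'|exact: Crule Ck].
have : s - e n <= N (fun y => 2^-1 * (k n.+1 y + k n y)).
  have [mm|/ltnW mm] := leqP (m n) (m n.+1).
    by apply: sk; apply: Cmid => //; exact: Cdecr Ck'.
  apply: le_trans (sk' _ _); first by have := eS n; lra.
  by apply: Cmid => //; exact: Cdecr Ck.
move: Nk Nk' (eS n); rewrite /N /e; lra.
Qed.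

(** The weighted increments have summable integrals, so their sum is finite
    almost everywhere and [k n y] is a Cauchy sequence where [w y] is positive. *)
Lemma ae_cvg_fast_cauchy k : (forall n, measurable_fun setT (k n)) ->
  (forall n y, `|k n y| <= 1) ->
  (forall n, \int[mu]_y ((k n.+1 y - k n y) ^+ 2 * w y) <= 4^-1 ^+ n) ->
  {ae mu, forall y, w y != 0 -> cvgn (fun n => k n y)}.
Proof.
move=> mk k1 kfast.
pose v n y : R := `|k n.+1 y - k n y|.
have mv n : measurable_fun setT (v n).
  by apply: measurableT_comp => //; exact: measurable_funB.
have v0 n y : 0 <= v n y by exact: normr_ge0.
have v2 n y : v n y <= 2.
  by rewrite (le_trans (ler_normB _ _))// (natrD _ 1 1) lerD.
have iv n : mu.-integrable setT (EFin \o (fun y => v n y * w y)).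
  by apply: (integrable_bounded_mul (C := 2)) => // y; rewrite normr_id v2.
have iv2 n : mu.-integrable setT (EFin \o (fun y => (k n.+1 y - k n y) ^+ 2 * w y)).
  apply: (integrable_bounded_mul (C := 4)) => //.
    by apply: measurable_funX; exact: measurable_funB.
  move=> y; rewrite normrX -/(v n y).
  have -> : 4 = 2 * 2 :> R by ring.
  by rewrite expr2 ler_pM ?v2 ?v0.
pose W := \int[mu]_y w y.
have W0 : 0 <= W by exact: Rintegral_ge0.
have vint n : \int[mu]_y (v n y * w y) <= (1 + W) * 2^-1 ^+ n.
  (* Here 2 a b <= a ^+ 2 + b ^+ 2, with a = 2^-1 ^+ n and b the increment,
     plays the role of the Cauchy-Schwarz inequality. *)
  have q0 : 0 < 2^-1 ^+ n :> R by rewrite exprn_gt0.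
  apply: (@le_trans _ _ (\int[mu]_y (2^-1 ^+ n * w y +
      2 ^+ n * ((k n.+1 y - k n y) ^+ 2 * w y)))).
    apply: le_Rintegral => //.
      by apply: integrableD_fun => //; exact: integrableZl_fun.
    move=> y _; rewrite mulrA -mulrDl; apply: ler_wpM2r => //.
    have -> : (k n.+1 y - k n y) ^+ 2 = v n y ^+ 2 by rewrite /v real_normK ?num_real.
    have q1 : 2^-1 ^+ n * 2 ^+ n = 1 :> R.
      by rewrite -exprMn mulVf ?expr1n.
    have q2 : 0 < 2 ^+ n :> R by rewrite exprn_gt0.
    have := sqr_ge0 (2^-1 ^+ n - v n y).
    have := sqr_ge0 (v n y); have := v0 n y; nra.
  rewrite RintegralD//; [|exact: integrableZl_fun|exact: integrableZl_fun].
  rewrite !RintegralZl// mulrDl mul1r addrC [W * _]mulrC lerD2r.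
  have -> : 2^-1 ^+ n = 2 ^+ n * 4^-1 ^+ n :> R.
    by rewrite -exprMn; congr (_ ^+ _); field.
  by rewrite ler_wpM2l// exprn_ge0.
have ivsum : (\int[mu]_y (\sum_(n <oo) (v n y * w y)%:E) < +oo)%E.
  rewrite integral_nneseries//; last 2 first.
  - by move=> n; exact: measurable_int (iv n).
  - by move=> n y _; rewrite lee_fin mulr_ge0 ?v0 ?w0.
  apply: (@le_lt_trans _ _ (\sum_(n <oo) (geometric (1 + W) 2^-1 n)%:E)%E).
    apply: lee_nneseries => [n _ _|n _].
      by apply: integral_ge0 => y _; rewrite lee_fin mulr_ge0 ?v0 ?w0.
    by rewrite -(fineK (integrable_fin_num measurableT (iv n))) lee_fin vint.
  have := @cvg_geometric_series R (1 + W) 2^-1.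
  have -> : `|2^-1 : R| < 1 by rewrite ger0_norm; lra.
  move=> /(_ isT) cg.
  have /cvg_lim -> // : (\sum_(0 <= i < n) (geometric (1 + W) 2^-1 i)%:E)%E @[n --> \oo]
     --> ((1 + W) * (1 - 2^-1)^-1)%:E.
    rewrite (_ : (fun n => _) = EFin \o series (geometric (1 + W) 2^-1)).
      by apply: cvg_EFin => //; exact: nearW.
    by apply/funext => n /=; rewrite sumEFin.
  exact: ltry.
have : {ae mu, forall y, setT y -> (\sum_(n <oo) (v n y * w y)%:E)%E \is a fin_num}.
  apply: (integrable_ae measurableT); apply/integrableP; split.
    apply: ge0_emeasurable_sum => [n y _ _|n _]; first by rewrite lee_fin mulr_ge0 ?v0 ?w0.
    exact: measurable_int (iv n).
  rewrite (eq_integral (fun y => (\sum_(n <oo) (v n y * w y)%:E)%E))// => y _.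
  by rewrite gee0_abs// nneseries_ge0// => n _ _; rewrite lee_fin mulr_ge0 ?v0 ?w0.
apply: filterS => y /(_ I) finy wy.
have wy0 : 0 < w y by rewrite lt0r wy w0.
have cvg_v : cvgn [normed series (telescope (k ^~ y))].
  apply: nondecreasing_is_cvgn.
    by apply: nondecreasing_series => n _ _; exact: normr_ge0.
  exists (fine (\sum_(n <oo) (v n y * w y)%:E)%E / w y) => _ [n _ <-] /=.
  rewrite ler_pdivlMr// -lee_fin fineK// mulr_suml -sumEFin.
  by apply: nneseries_lim_ge => i _ _; rewrite lee_fin mulr_ge0 ?v0 ?w0.
have /cvg_ex[l cl] := normed_cvg cvg_v.
apply/cvg_ex; exists (k 0%N y + l).
rewrite [X in X @ _ --> _](_ : _ = (fun n => k 0%N y + series (telescope (k ^~ y)) n)).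
  by apply: cvgD => //; exact: cvg_cst.
by apply/funext => n; exact: eq_sum_telescope.
Qed.

Lemma ae_cvg_rule k : (forall n, decision_rule (k n)) ->
  {ae mu, forall y, w y != 0 -> cvgn (fun n => k n y)} ->
  exists h, decision_rule h /\
    {ae mu, forall y, w y != 0 -> k n y @[n --> \oo] --> h y}.
Proof.
move=> rk ck.
(* The clamp keeps the values in the unit interval where there is no limit. *)
exists (fun y => Num.min 1 (Num.max 0 (limn_sup (k ^~ y)))).
split; first split.
- apply: measurable_minr => //; apply: measurable_maxr => //.
  apply: measurable_fun_limn_sup => [y _|y _|n]; last by have [] := rk n.
    by exists 1 => _ [n _ <-]; have /andP[] := (rk n).2 y.
  by exists 0 => _ [n _ <-]; have /andP[] := (rk n).2 y.
- by move=> y; rewrite le_min ler01 le_max lexx/= ge_min lexx.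
- apply: filterS ck => y cky wy.
  have cy := cky wy.
  have l0 : 0 <= limn (k ^~ y).
    by apply: limr_ge => //; apply: nearW => n; have /andP[] := (rk n).2 y.
  have l1 : limn (k ^~ y) <= 1.
    by apply: limr_le => //; apply: nearW => n; have /andP[] := (rk n).2 y.
  by rewrite cvg_limn_supE// (max_idPr l0) (min_idPr l1).
Qed.

End NearMinimalRules.

(** * Sequential weak compactness of the set of decision rules *)

Section DiagonalCluster.
Context {R : realType}.

(** A cluster point in a product of segments, which is compact, replaces the
    extraction of a diagonal subsequence: a neighbourhood of [c] constrains
    finitely many coordinates, and the sequence visits it infinitely often. *)
Lemma bounded_double_seq_cluster (X : nat -> nat -> R) (b : nat -> R) :
  (forall n k, `|X n k| <= b k) ->
  exists c : nat -> R, forall m, exists n, (m <= n)%N /\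
    forall k, (k <= m)%N -> `|X n k - c k| <= m.+1%:R^-1.
Proof.
move=> Xb.
have cb k : compact (`[- b k, b k]%classic : set R) by exact: segment_compact.
have cA := @tychonoff nat (fun=> R^o) (fun k => `[- b k, b k]%classic) cb.
have [|c [_ cl]] := cA (X @ \oo) (fmap_proper_filter X _).
  by exists 0%N => // n _ k /=; rewrite in_itv/= -ler_norml.
exists c => m.
have near_c M : nbhs c [set x : nat -> R^o | forall k, (k < M)%N ->
    `|x k - c k| <= m.+1%:R^-1].
  elim: M => [|M IH]; first by apply: filterS (filterT : nbhs c setT).
  have : nbhs c [set x : nat -> R^o | `|x M - c M| <= m.+1%:R^-1].
    have pM : (fun x : nat -> R^o => x M : R) @ nbhs c --> (c M : R).
      exact: (@proj_continuous nat (fun=> R^o) M c).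
    have e0 : 0 < m.+1%:R^-1 :> R by rewrite invr_gt0.
    have cM : nbhs c [set x : nat -> R^o | `|c M - x M| <= m.+1%:R^-1].
      exact: (cvgrPdist_le _ _).1 pM _ e0.
    by apply: filterS cM => x /=; rewrite distrC.
  apply: filterS2 IH => x IH xM k.
  by rewrite ltnS leq_eqVlt => /predU1P[->//|/IH].
have [|x [[n mn <-] H]] := cl (X @` [set n | (m <= n)%N]) _ _ (near_c m.+1).
  by exists m => // n /= mn; exists n.
by exists n; split => // k km; exact: H.
Qed.

End DiagonalCluster.

Section WeakCompactness.
Context {R : realType} {d : measure_display} {Y : measurableType d}.
Variable mu : {measure set Y -> \bar R}.

Lemma cvg_of_le_invn (j : nat) (u : nat -> R) (l : R) :
  (forall n, (j <= n)%N -> `|u n - l| <= n.+1%:R^-1) -> u n @[n --> \oo] --> l.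
Proof.
move=> ul; apply/cvgrPdist_le => e e0; near=> n.
have jn : (j <= n)%N by near: n; exact: nbhs_infty_ge.
rewrite distrC (le_trans (ul n jn))// ltW//; near: n.
exact: (near_infty_natSinv_lt (PosNum e0)).
Unshelve. all: by end_near. Qed.

(** The rules whose integrals against [phi 0], ..., [phi n] are within
    [1/(n+1)] of a cluster point of the given sequence of integrals form a
    nonempty convex set [C n]; almost norm-minimal elements of the [C n]
    converge almost everywhere, hence under the integral against each [phi k].
    The bound [n <= s n] says that the chosen terms lie in the tails of the
    sequence. *)
Lemma rule_seq_weak_compact (w : Y -> R) (phi : nat -> Y -> R)
    (delta : nat -> Y -> R) :
  (forall y, 0 <= w y) -> mu.-integrable setT (EFin \o w) ->
  (forall k, mu.-integrable setT (EFin \o phi k)) ->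
  (forall k, {ae mu, forall y, w y = 0 -> phi k y = 0}) ->
  (forall n, decision_rule (delta n)) ->
  exists h (s : nat -> nat), [/\ decision_rule h, forall n, (n <= s n)%N & forall k,
    \int[mu]_y (delta (s n) y * phi k y) @[n --> \oo] -->
    \int[mu]_y (h y * phi k y)].
Proof.
move=> w0 iw iphi wphi rdelta.
have ihphi h k : decision_rule h ->
    mu.-integrable setT (EFin \o (fun y => h y * phi k y)).
  by move=> rh; exact: integrable_rule_mul.
pose X n k := \int[mu]_y (delta n y * phi k y).
pose b k := \int[mu]_y `|phi k y|.
have Xb n k : `|X n k| <= b k.
  apply: le_trans (le_normr_Rintegral _ _) _ => //; first exact: ihphi.
  apply: le_Rintegral => //.
  - exact/integrable_norm/ihphi.
  - exact: integrable_norm.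
  - move=> y _; have /andP[h0 h1] := (rdelta n).2 y.
    by rewrite normrM ler_piMl// ger0_norm.
have [c cX] := bounded_double_seq_cluster Xb.
pose C n := [set h : Y -> R | decision_rule h /\ forall k, (k <= n)%N ->
  `|\int[mu]_y (h y * phi k y) - c k| <= n.+1%:R^-1].
have [|||n h|k [Ck kfast]] := @near_minimal_sequence R d Y mu w w0 iw C.
- by move=> n; have [m [nm mc]] := cX n; exists (delta m); split.
- move=> m n mn h [rh hc]; split => // k km.
  apply: le_trans (hc _ (leq_trans km mn)) _.
  by rewrite lef_pV2 ?posrE// ler_nat.
- move=> n h h' [rh hc] [rh' hc']; split; first exact: rule_mid.
  move=> k kn.
  rewrite (@eq_Rintegral _ _ _ mu setT (fun y => 2^-1 * (h y * phi k y + h' y * phi k y))); last first.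
    by move=> y _; ring.
  rewrite RintegralZl//; last by apply: integrableD_fun; exact: ihphi.
  rewrite RintegralD//; [|exact: ihphi|exact: ihphi].
  have := hc _ kn; have := hc' _ kn; rewrite !ler_norml.
  by move: n.+1%:R^-1 => r /andP[? ?] /andP[? ?]; apply/andP; split; lra.
- by case.
have mk n : measurable_fun setT (k n) by have [[]] := Ck n.
have k1 n y : `|k n y| <= 1.
  by have [[_ /(_ y)/andP[k0 k1]] _] := Ck n; rewrite ger0_norm.
have [h [rh kh]] := ae_cvg_rule (fun n => (Ck n).1)
  (ae_cvg_fast_cauchy w0 iw mk k1 kfast).
have [s cs] := choice cX.
exists h, s; split => // [n|j]; first exact: (cs n).1.
have hc : \int[mu]_y (h y * phi j y) = c j.
  have : \int[mu]_y (k n y * phi j y) @[n --> \oo] --> \int[mu]_y (h y * phi j y).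
    apply: (@dominated_cvg_Rintegral _ _ _ mu _ _ (fun y => `|phi j y|)).
    - by move=> n; exact/measurable_EFinP/(measurable_int mu)/ihphi/(Ck n).1.
    - exact/measurable_EFinP/(measurable_int mu)/ihphi.
    - apply: filterS2 kh (wphi j) => y ky wy.
      have [/wy ->|/ky kcv] := eqVneq (w y) 0.
        by rewrite mulr0; under eq_fun do rewrite mulr0; exact: cvg_cst.
      by apply: cvgM => //; exact: cvg_cst.
    - exact: integrable_norm.
    - by move=> n y; rewrite normrM ler_piMl.
  move=> cvh; apply: (cvg_unique _ cvh) => //.
  by apply: (@cvg_of_le_invn j) => n jn; exact: (Ck n).2.
by rewrite hc; apply: (@cvg_of_le_invn j) => n jn; exact: (cs n).2.
Qed.

End WeakCompactness.

(** * Compact sets and sequences *)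

Section Topology.
Context {R : realType} {V : normedModType R}.

(** Stated with convergent sequences because the continuity assumption on the
    parametrized family of densities is sequential. *)
Lemma compact_dense_sequence (A : set V) : A !=set0 -> compact A ->
  exists D : nat -> V, (forall k, A (D k)) /\
    forall x, A x -> exists u : nat -> nat, D (u n) @[n --> \oo] --> x.
Proof.
move=> [x0 Ax0]; rewrite compact_cover => cA.
have fin n : exists s : seq V, {in s, forall x, A x} /\
    forall x, A x -> exists2 y, y \in s & ball y n.+1%:R^-1 x.
  have [|x Ax|D' D'A AD'] := cA V A (fun y => ball y n.+1%:R^-1).
  - by move=> i _; exact: ball_open.
  - by exists x => //; apply: ballxx; rewrite invr_gt0.
  - exists (finmap.enum_fset D'); split=> [x xD|x Ax].
      by have := D'A x xD; rewrite inE.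
    by have [y /= yD yx] := AD' x Ax; exists y.
have [s sP] := choice fin.
(* A default value when [p.2] is out of range does no harm: [x0] is in [A]. *)
pose D m := let p := odflt (0%N, 0%N) (unpickle m) in nth x0 (s p.1) p.2.
exists D; split=> [k|x Ax].
  rewrite /D; set p := odflt _ _; have [pm|pm] := ltnP p.2 (size (s p.1)).
    by apply: (sP p.1).1; exact: mem_nth.
  by rewrite nth_default.
have step n : exists m, ball (D m) n.+1%:R^-1 x.
  have [y ys yx] := (sP n).2 x Ax.
  by exists (pickle (n, index y (s n))); rewrite /D pickleK/= nth_index.
have [u ux] := choice step; exists u.
apply/cvgrPdist_lt => e e0; near=> n.
rewrite distrC; have := ux n; rewrite -ball_normE/= => /lt_trans; apply.
near: n; exact: (near_infty_natSinv_lt (PosNum e0)).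
Unshelve. all: by end_near. Qed.

Lemma seq_continuous_within (A : set V) (h : V -> R) :
  (forall (u : nat -> V) x, (forall n, A (u n)) -> A x ->
    u n @[n --> \oo] --> x -> h (u n) @[n --> \oo] --> h x) ->
  {within A, continuous h}.
Proof.
move=> hseq; apply/subspace_continuousP => x Ax.
apply/cvgrPdist_lt => e e0; apply: contrapT => noh.
have step n : exists y, [/\ A y, ball x n.+1%:R^-1 y & e <= `|h x - h y|].
  apply: contrapT => /forallNP noy; apply: noh.
  rewrite near_withinE; near=> y => Ay; rewrite ltNge; apply/negP => exy.
  apply: (noy y); split => //; near: y.
  by apply: nbhsx_ballx; rewrite invr_gt0.
have [u uP] := choice step.
have ux : u n @[n --> \oo] --> x.
  apply/cvgrPdist_lt => r r0; near=> n.
  have [_ + _] := uP n; rewrite -ball_normE/= => /lt_trans; apply.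
  by near: n; exact: (near_infty_natSinv_lt (PosNum r0)).
have /cvgrPdist_lt/(_ e e0) := hseq u x (fun n => let: And3 a _ _ := uP n in a) Ax ux.
move=> [N _ /(_ N (leqnn N))/=]; have [_ _] := uP N.
by rewrite leNgt => /negP.
Unshelve. all: by end_near. Qed.

Lemma within_continuous_seq {U W : topologicalType} (A : set U) (h : U -> W) (u : nat -> U) x :
  {within A, continuous h} -> (forall n, A (u n)) -> A x ->
  u n @[n --> \oo] --> x -> h (u n) @[n --> \oo] --> h x.
Proof.
move=> /subspace_continuousP hA Au Ax ux.
have uw : u n @[n --> \oo] --> within A (nbhs x).
  move=> B /ux uB; have : \forall n \near \oo, A (u n) -> B (u n) by exact: uB.
  by apply: filterS => n /(_ (Au n)).
exact: cvg_comp uw (hA x Ax).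
Qed.

End Topology.

(** * Functions that are C1 inside the unit interval *)

Section RealFunctions.
Context {R : realType}.
Variable g : R -> R.
Hypothesis gC1 : C1_inside_continuous_at_ends g.

Lemma C1_within01 : {within `[0, 1], continuous g}.
Proof.
have [dg _ g0 g1] := gC1.
apply/continuous_within_itvP => //; split=> // t; rewrite in_itv/= => t01.
exact/differentiable_continuous/derivable1_diffP/dg.
Qed.

Lemma C1_bounded01 : exists M, forall t, 0 <= t <= 1 -> `|g t| <= M.
Proof.
have /compact_bounded[M [_ gM]] := continuous_compact C1_within01 (@segment_compact R 0 1).
exists (M + 1) => t t01; apply: (gM (M + 1)); first by rewrite ltrDl.
by exists t => //=; rewrite in_itv.
Qed.

Lemma C1_increasing01 : (forall t, 0 < t < 1 -> 0 < derive1 g t) ->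
  forall s t, 0 <= s -> s < t -> t <= 1 -> g s < g t.
Proof.
move=> dg0 s t; have [dg _ _ _] := gC1.
apply: (@gtr0_derive1_incr _ _ 0 1) => [x|x|]; last exact: C1_within01.
  by rewrite in_itv/=; exact: dg.
by rewrite in_itv/=; exact: dg0.
Qed.

Lemma derive1_bounded (a b : R) : 0 < a -> b < 1 ->
  exists M, forall t, a <= t <= b -> `|derive1 g t| <= M.
Proof.
move=> a0 b1; have [_ cg _ _] := gC1.
have [ab|ba] := leP a b; last first.
  by exists 0 => t /andP[at_ tb]; have := le_trans at_ tb; lra.
have cw : {within `[a, b], continuous (derive1 g)}.
  apply: continuous_in_subspaceT => t; rewrite inE/= in_itv/= => /andP[at_ tb].
  by apply: cg; rewrite (lt_le_trans a0 at_) (le_lt_trans tb b1).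
have /compact_bounded[M [_ gM]] := continuous_compact cw (@segment_compact R a b).
exists (M + 1) => t t01; apply: (gM (M + 1)); first by rewrite ltrDl.
by exists t => //=; rewrite in_itv.
Qed.

(** Confining the intermediate point to [[a, b]] bounds the difference quotients
    of [g], and its distance to [p] identifies their limit. *)
Lemma C1_mean_value (a b p q : R) : 0 < a -> b < 1 ->
  a <= p <= b -> a <= q <= b -> exists c,
    [/\ a <= c <= b, `|c - p| <= `|q - p| &
        g q - g p = derive1 g c * (q - p)].
Proof.
move=> a0 b1; have [dg _ _ _] := gC1.
have mv s t : a <= s <= b -> a <= t <= b -> s <= t ->
    exists2 c, s <= c <= t & g t - g s = derive1 g c * (t - s).
  move=> /andP[as_ sb] /andP[at_ tb] st.
  have d x : s <= x <= t -> derivable g x 1.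
    by move=> /andP[sx xt]; apply: dg; apply/andP; split; lra.
  have [|//|c cst ->] := @MVT_segment _ g (derive1 g) s t st.
  - move=> x; rewrite in_itv/= => /andP[sx xt]; rewrite derive1E.
    by apply/derivableP/d; rewrite !ltW.
  - by apply: derivable_within_continuous => x; rewrite in_itv/=; exact: d.
  - by exists c => //; rewrite in_itv/= in cst.
move=> pab qab; have [pq|/ltW qp] := leP p q.
  have [c /andP[pc cq] gc] := mv _ _ pab qab pq; exists c; split => //.
    by move: pab qab; lra.
  by rewrite !ger0_norm ?subr_ge0// lerD2r.
have [c /andP[qc cp] gc] := mv _ _ qab pab qp; exists c; split => //.
- by move: pab qab; lra.
- by rewrite !ler0_norm ?subr_le0// lerN2 lerD2r.
- by rewrite -opprB gc; ring.
Qed.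

End RealFunctions.

(** * Rules that maximize a linear functional at a given size *)

Section NeymanPearson.
Context {R : realType} {d : measure_display} {Y : measurableType d}.
Variable mu : {measure set Y -> \bar R}.
Variables w H delta : Y -> R.
Hypothesis w0 : forall y, 0 <= w y.
Hypothesis iw : mu.-integrable setT (EFin \o w).
Hypothesis iH : mu.-integrable setT (EFin \o H).
Hypothesis rdelta : decision_rule delta.
Hypothesis delta_max : forall delta', decision_rule delta' ->
  \int[mu]_y (delta' y * w y) = \int[mu]_y (delta y * w y) ->
  \int[mu]_y (delta' y * H y) <= \int[mu]_y (delta y * H y).

Let mw : measurable_fun setT w.
Proof. exact/measurable_EFinP/(measurable_int mu iw). Qed.

Let mH : measurable_fun setT H.
Proof. exact/measurable_EFinP/(measurable_int mu iH). Qed.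

Let mdelta : measurable_fun setT delta. Proof. by case: rdelta. Qed.

Let delta01 y : 0 <= delta y <= 1. Proof. by case: rdelta. Qed.

(** If both alternatives fail, raising [delta] where [k w < H] and lowering it
    where [H < k w], in proportions that preserve its [w]-integral, strictly
    increases its integral against [H]. *)
Lemma swap_dichotomy k :
  {ae mu, forall y, k * w y < H y -> delta y = 1} \/
  {ae mu, forall y, H y < k * w y -> delta y = 0}.
Proof.
have [hA|nA] := pselect {ae mu, forall y, k * w y < H y -> delta y = 1}.
  by left.
right; apply: contrapT => nB.
pose A := [set y | k * w y < H y]; pose B := [set y | H y < k * w y].
have mA : measurable A.
  apply: measurable_set_lt => //; exact: measurable_funM.
have mB : measurable B.
  apply: measurable_set_lt => //; exact: measurable_funM.
pose a y : R := (1 - delta y) * \1_A y.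
pose b y : R := delta y * \1_B y.
have ma : measurable_fun setT a.
  by apply: measurable_funM => //; exact: measurable_funB.
have mb : measurable_fun setT b.
  by apply: measurable_funM.
have a01 y : 0 <= a y <= 1.
  by rewrite /a indicE; have := delta01 y; case: (y \in A) => /=; rewrite ?(mulr1, mulr0); lra.
have b01 y : 0 <= b y <= 1.
  by rewrite /b indicE; have := delta01 y; case: (y \in B) => /=; rewrite ?(mulr1, mulr0); lra.
have int (h v : Y -> R) : measurable_fun setT h -> (forall y, 0 <= h y <= 1) ->
    mu.-integrable setT (EFin \o v) ->
    mu.-integrable setT (EFin \o (fun y => h y * v y)).
  by move=> mh h01; exact: (integrable_rule_mul (conj mh h01)).
pose u := \int[mu]_y (a y * w y); pose v := \int[mu]_y (b y * w y).
have u0 : 0 <= u.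
  by apply: Rintegral_ge0 => y _; have /andP[? _] := a01 y; rewrite mulr_ge0.
have v0 : 0 <= v.
  by apply: Rintegral_ge0 => y _; have /andP[? _] := b01 y; rewrite mulr_ge0.
have iHw : mu.-integrable setT (EFin \o (fun y => H y - k * w y)).
  by apply: integrableB_fun => //; exact: integrableZl_fun.
have P0 : 0 < \int[mu]_y (a y * (H y - k * w y)).
  apply: Rintegral_gt0; first exact: int.
    move=> y; rewrite /a indicE; have := delta01 y.
    have [yA|_] := boolP (y \in A); last by rewrite mulr0 mul0r.
    by move: yA; rewrite inE /A/= mulr1 => yA d01; rewrite mulr_ge0; lra.
  move=> a0; apply: nA; apply: filterS a0 => y + yA.
  by rewrite /a indicE mem_set// mulr1 => /eqP; rewrite mulf_eq0; lra.
have Q0 : 0 < - \int[mu]_y (b y * (H y - k * w y)).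
  rewrite -mulN1r -RintegralZl//; last exact: int.
  apply: Rintegral_gt0; first by apply: integrableZl_fun; exact: int.
    move=> y; rewrite /b indicE; have := delta01 y.
    have [yB|_] := boolP (y \in B); last by rewrite mulr0 mul0r mulr0.
    by move: yB; rewrite inE /B/= mulr1 => yB d01; nra.
  move=> b0; apply: nB; apply: filterS b0 => y + yB.
  rewrite /b indicE mem_set// mulr1 => /eqP; rewrite !mulf_eq0.
  by move: yB; rewrite /B/=; lra.
(* With [u + v = 0] no [w]-mass moves, and both changes can be made in full. *)
have [c [e [c01 e01 cuev ce0]]] : exists c e : R,
    [/\ 0 <= c <= 1, 0 <= e <= 1, c * u = e * v & 0 < c + e].
  have [uv0|uv0] := eqVneq (u + v) 0.
    by exists 1, 1; split; lra.
  exists (v / (u + v)), (u / (u + v)).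
  have uv1 : 0 < u + v by rewrite lt0r uv0 addr_ge0.
  split.
  - by rewrite ler_pdivlMr// ler_pdivrMr// mul0r mul1r lerDr v0 u0.
  - by rewrite ler_pdivlMr// ler_pdivrMr// mul0r mul1r lerDl v0 u0.
  - by rewrite mulrAC [RHS]mulrAC [v * u]mulrC.
  - by rewrite -mulrDl addrC divff.
pose delta' y := delta y + (c * a y + - e * b y).
have rdelta' : decision_rule delta'.
  split.
    apply: measurable_funD => //; apply: measurable_funD => //;
    exact: measurable_funM.
  move=> y; rewrite /delta' /a /b !indicE; have := delta01 y.
  have [yA|_] := boolP (y \in A); have [yB|_] := boolP (y \in B);
    rewrite /= ?(mulr1, mulr0, addr0, add0r).
  - by move: yA yB; rewrite !inE /A/B/=; lra.
  - by move: c01; nra.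
  - by move: e01; nra.
  - by [].
have ilin (h : Y -> R) : mu.-integrable setT (EFin \o h) -> \int[mu]_y (delta' y * h y) =
    \int[mu]_y (delta y * h y) +
    (c * \int[mu]_y (a y * h y) - e * \int[mu]_y (b y * h y)).
  move=> ih; rewrite -mulNr -!RintegralZl//; [|exact: int|exact: int].
  rewrite -RintegralD//; [|exact/integrableZl_fun/int|exact/integrableZl_fun/int].
  rewrite -RintegralD//; [|exact: int|]; last first.
    by apply: integrableD_fun; exact/integrableZl_fun/int.
  by apply: eq_Rintegral => y _; rewrite /delta'; ring.
have split_int (h : Y -> R) : measurable_fun setT h -> (forall y, 0 <= h y <= 1) ->
    \int[mu]_y (h y * (H y - k * w y)) =
    \int[mu]_y (h y * H y) - k * \int[mu]_y (h y * w y).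
  move=> mh h01; rewrite -RintegralZl//; last exact: int.
  rewrite -RintegralB//; [|exact: int|exact/integrableZl_fun/int].
  by apply: eq_Rintegral => y _; ring.
have := delta_max rdelta'; rewrite !ilin// => dm.
have {}dm := dm ltac:(rewrite -/u -/v cuev subrr addr0 //).
move: P0 Q0; rewrite !split_int// -/u -/v.
set aH := \int[mu]_y (a y * H y) in dm *; set bH := \int[mu]_y (b y * H y) in dm *.
move=> P0 Q0.
have /andP[c0 _] := c01; have /andP[e0 _] := e01.
have := mulr_ge0 c0 (ltW P0); have := mulr_ge0 e0 (ltW Q0).
have kuv : k * (c * u) = k * (e * v) by rewrite cuev.
have [c_gt0|] := ltP 0 c.
  by have := mulr_gt0 c_gt0 P0; lra.
move=> c_le0; have e_gt0 : 0 < e by lra.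
by have := mulr_gt0 e_gt0 Q0; lra.
Qed.

Lemma threshold_monotone k k' : k <= k' ->
  {ae mu, forall y, k * w y < H y -> delta y = 1} ->
  {ae mu, forall y, k' * w y < H y -> delta y = 1}.
Proof.
move=> kk'; apply: filterS => y dy kH; apply: dy.
by apply: le_lt_trans kH; rewrite ler_wpM2r.
Qed.

Lemma invn_slope_lt (c x : R) : 0 < c -> 0 <= x -> exists n, n.+1%:R^-1 * x < c.
Proof.
move=> c0 x0; exists (Num.truncn (x / c)).
rewrite mulrC ltr_pdivrMr ?ltr0n// -ltr_pdivrMl// mulrC.
exact: truncnS_gt.
Qed.

(** The levels [k] such that [delta = 1] where [k w < H] form an up-closed set,
    and [delta = 0] where [H < k w] at all the others; [kappa] is the infimum
    of that set.  It is finite because [delta] is neither 0 nor 1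
    [w]-almost everywhere. *)
Lemma neyman_pearson_threshold :
  0 < \int[mu]_y (delta y * w y) < \int[mu]_y w y ->
  exists kappa, {ae mu, forall y, (kappa * w y < H y -> delta y = 1) /\
                                  (H y < kappa * w y -> delta y = 0)}.
Proof.
move=> /andP[p0 p1].
pose K := [set k | {ae mu, forall y, k * w y < H y -> delta y = 1}].
have notK k : ~ K k -> {ae mu, forall y, H y < k * w y -> delta y = 0}.
  by move=> nK; have [] := swap_dichotomy k.
have mdw : measurable_fun setT (fun y => delta y * w y) by exact: measurable_funM.
have K0 : K !=set0.
  apply/set0P/eqP => K0.
  have : {ae mu, forall y, delta y * w y = 0}.
    have : {ae mu, forall y, forall n : nat, H y < n%:R * w y -> delta y = 0}.
      by apply: ae_foralln => n; apply: notK; rewrite K0.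
    apply: filterS => y dy.
    have [->|wy] := eqVneq (w y) 0; first by rewrite mulr0.
    have wy0 : 0 < w y by rewrite lt0r wy w0.
    rewrite (dy (Num.truncn (H y / w y)).+1) ?mul0r//.
    rewrite -ltr_pdivrMr//; exact: truncnS_gt.
  move=> ae0; move: p0.
  have -> : \int[mu]_y (delta y * w y) = \int[mu]_(y in setT) 0.
    by apply: ae_eq_Rintegral.
  by rewrite /Rintegral integral0 ltxx.
have Klb : has_lbound K.
  apply: contrapT => nlb.
  have Kn (n : nat) : K (- n%:R).
    apply: contrapT => nK; apply: nlb; exists (- n%:R) => k Kk.
    rewrite leNgt; apply/negP => kn; apply: nK.
    exact: threshold_monotone (ltW kn) Kk.
  have : {ae mu, forall y, delta y * w y = w y}.
    have : {ae mu, forall y, forall n : nat, - n%:R * w y < H y -> delta y = 1}.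
      by apply: ae_foralln => n; exact: Kn.
    apply: filterS => y dy.
    have [->|wy] := eqVneq (w y) 0; first by rewrite mulr0.
    have wy0 : 0 < w y by rewrite lt0r wy w0.
    rewrite (dy (Num.truncn (- H y / w y)).+1) ?mul1r//.
    rewrite mulNr ltrNl -ltr_pdivrMr//; exact: truncnS_gt.
  move=> ae1; move: p1.
  by rewrite (ae_eq_Rintegral mdw mw ae1) ltxx.
exists (inf K).
have K1 : {ae mu, forall y, forall n : nat, (inf K + n.+1%:R^-1) * w y < H y -> delta y = 1}.
  apply: ae_foralln => n.
  have n0 : 0 < n.+1%:R^-1 :> R by rewrite invr_gt0.
  have [k Kk kn] := inf_adherent n0 (conj K0 Klb).
  exact: threshold_monotone (ltW kn) Kk.
have K2 : {ae mu, forall y, forall n : nat, H y < (inf K - n.+1%:R^-1) * w y -> delta y = 0}.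
  apply: ae_foralln => n; apply: notK => /(ge_inf Klb).
  by rewrite leNgt ltrBlDr ltrDl invr_gt0 ltr0n.
apply: filterS2 K1 K2 => y K1 K2; split=> kH.
  have [n ny] := @invn_slope_lt (H y - inf K * w y) (w y) ltac:(lra) (w0 y).
  by apply: (K1 n); rewrite mulrDl addrC -ltrBrDr.
have [n ny] := @invn_slope_lt (inf K * w y - H y) (w y) ltac:(lra) (w0 y).
by apply: (K2 n); rewrite mulrBl ltrBrDr addrC -ltrBrDr.
Qed.

End NeymanPearson.

(** * Power functions *)

Section Power.
Context {R : realType} {d1 : nat} {d : measure_display} {Y : measurableType d}.
Variables (mu : {measure set Y -> \bar R}) (f : 'rV[R]_d1 -> Y -> R).
Variable Theta : set 'rV[R]_d1.
Hypothesis fd : forall theta, Theta theta -> is_density mu (f theta).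
Implicit Types (theta : 'rV[R]_d1) (delta : Y -> R).

Lemma density_integrable theta : Theta theta ->
  mu.-integrable setT (EFin \o f theta).
Proof.
move=> /fd[mf f0 f1]; apply/integrableP; split; first exact/measurable_EFinP.
under eq_integral => y _ do rewrite /= ger0_norm//.
by rewrite f1 ltry.
Qed.

Lemma density_Rintegral theta : Theta theta -> \int[mu]_y f theta y = 1.
Proof. by move=> /fd[mf f0 f1]; rewrite /Rintegral f1. Qed.

Let irule theta delta (t : Theta theta) (r : decision_rule delta) :=
  integrable_rule_mul r (density_integrable t).

Lemma power_ge0 theta delta : Theta theta -> decision_rule delta ->
  0 <= power mu f theta delta.
Proof.
move=> /fd[_ f0 _] [_ delta01]; apply: Rintegral_ge0 => y _.
by have /andP[? _] := delta01 y; rewrite mulr_ge0.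
Qed.

Lemma power_le1 theta delta : Theta theta -> decision_rule delta ->
  power mu f theta delta <= 1.
Proof.
move=> t r; rewrite -(density_Rintegral t); have [_ f0 _] := fd t.
apply: le_Rintegral => //; [exact: irule|exact: density_integrable|].
by move=> y _; have /andP[? ?] := r.2 y; rewrite ler_piMl.
Qed.

Lemma power_segment theta delta delta' (s : R) : Theta theta ->
  decision_rule delta -> decision_rule delta' ->
  power mu f theta (fun y => delta y + s * (delta' y - delta y)) =
  power mu f theta delta +
  s * (power mu f theta delta' - power mu f theta delta).
Proof.
move=> t r r'; rewrite /power.
rewrite -RintegralB//; [|exact: irule|exact: irule].
rewrite -RintegralZl//; last by apply: integrableB_fun; exact: irule.
rewrite -RintegralD//; [|exact: irule|].
  by apply: eq_Rintegral => y _; ring.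
by apply: integrableZl_fun; apply: integrableB_fun; exact: irule.
Qed.

Lemma power_cst theta (a : R) : Theta theta -> power mu f theta (fun=> a) = a.
Proof.
move=> t; rewrite /power RintegralZl//; last exact: density_integrable.
by rewrite density_Rintegral// mulr1.
Qed.

Lemma power_ae_eq theta delta delta' : Theta theta ->
  decision_rule delta -> decision_rule delta' ->
  {ae mu, forall y, delta y = delta' y} ->
  power mu f theta delta = power mu f theta delta'.
Proof.
move=> t r r' dd'; apply: ae_eq_Rintegral.
- exact/measurable_EFinP/(measurable_int mu)/irule.
- exact/measurable_EFinP/(measurable_int mu)/irule.
- by apply: filterS dd' => y ->.
Qed.

(** The bound does not depend on [delta], so the power functions of all the
    rules are equicontinuous. *)
Lemma power_lipschitz theta theta' delta : Theta theta -> Theta theta' ->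
  decision_rule delta ->
  `|power mu f theta delta - power mu f theta' delta| <=
  \int[mu]_y `|f theta y - f theta' y|.
Proof.
move=> t t' r; have it := density_integrable t; have it' := density_integrable t'.
have iff := integrableB_fun it it'.
rewrite -RintegralB//; [|exact: irule|exact: irule].
rewrite (@eq_Rintegral _ _ _ mu setT (fun y => delta y * (f theta y - f theta' y))); last first.
  by move=> y _; ring.
apply: le_trans (le_normr_Rintegral _ _) _ => //; first exact: integrable_rule_mul.
apply: le_Rintegral => //.
- exact/integrable_norm/integrable_rule_mul.
- exact: integrable_norm.
- move=> y _; have /andP[? ?] := r.2 y.
  by rewrite normrM ler_piMl// ger0_norm.
Qed.

Section L1continuity.
Hypothesis fL1 : L1_continuous_on Theta mu f.

Lemma L1_cvg (u : nat -> 'rV[R]_d1) theta : (forall n, Theta (u n)) ->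
  Theta theta -> u n @[n --> \oo] --> theta ->
  \int[mu]_y `|f (u n) y - f theta y| @[n --> \oo] --> (0 : R).
Proof. by move=> tu t /(fL1 tu t)/fine_cvg. Qed.

Lemma power_continuous delta : decision_rule delta ->
  {within Theta, continuous (power mu f ^~ delta)}.
Proof.
move=> r; apply: seq_continuous_within => u theta tu t ut.
apply/cvgrPdist_le => e e0.
have /cvgrPdist_le/(_ e e0) := L1_cvg tu t ut.
apply: filterS => n; rewrite sub0r normrN => /(le_trans (ler_norm _)) ue.
by rewrite distrC (le_trans (power_lipschitz _ _ _)).
Qed.

Hypothesis cTheta : compact Theta.
Hypothesis fac : mutually_abs_continuous_on Theta mu f.

(** Makes [f theta0] a valid weight for almost-everywhere convergence under
    every density. *)
Lemma density_null_transfer theta theta' : Theta theta -> Theta theta' ->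
  {ae mu, forall y, f theta y = 0 -> f theta' y = 0}.
Proof.
move=> t t'; have [mf f0 _] := fd t; have [mf' f0' _] := fd t'.
pose A := [set y | f theta y = 0].
have mA : measurable A.
  by have := mf measurableT [set 0] (measurable_set1 0); rewrite setTI.
have Anull : null_set (measure_of_density mu (f theta)) A.
  by move=> B mB BA; apply: integral0_eq => y /BA ->.
have A0' := fac t' t Anull mA (@subset_refl _ A).
have : (\int[mu]_(y in A) `|(f theta' y)%:E| = 0)%E.
  by rewrite -[RHS]A0'; apply: eq_integral => y _; rewrite /= ger0_norm.
move/(ae_eq_integral_abs mu mA (measurable_funS measurableT (@subsetT _ A) ((measurable_EFinP _ _).2 mf'))).
by apply: filterS => y + fy0 => /(_ fy0) [].
Qed.

Lemma power_eq0_transfer theta theta' delta : Theta theta -> Theta theta' ->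
  decision_rule delta -> power mu f theta delta = 0 ->
  power mu f theta' delta = 0.
Proof.
move=> t t' r p0.
have d0 : {ae mu, forall y, delta y * f theta y = 0}.
  apply: contrapT => nd0.
  have := Rintegral_gt0 (irule t r) _ nd0.
  rewrite -/(power mu f theta delta) p0 ltxx => /(_ _)/notF; apply.
  move=> y; have /andP[? _] := r.2 y; have [_ f0 _] := fd t.
  by rewrite mulr_ge0.
have d0' : {ae mu, forall y, delta y * f theta' y = 0}.
  apply: filterS2 d0 (density_null_transfer t t') => y /eqP + ff'.
  by rewrite mulf_eq0 => /orP[/eqP ->|/eqP/ff' ->]; rewrite ?mul0r ?mulr0.
rewrite (_ : 0 = \int[mu]_(y in setT) 0); last by rewrite /Rintegral integral0.
apply: ae_eq_Rintegral => //.
exact/measurable_EFinP/(measurable_int mu)/irule.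
Qed.

Lemma power_eq1_transfer theta theta' delta : Theta theta -> Theta theta' ->
  decision_rule delta -> power mu f theta delta = 1 ->
  power mu f theta' delta = 1.
Proof.
move=> t t' r p1.
have r1 : decision_rule (fun y => 1 - delta y).
  split; first by apply: measurable_funB => //; case: r.
  by move=> y; have := r.2 y; lra.
have pC theta2 : Theta theta2 ->
    power mu f theta2 (fun y => 1 - delta y) = 1 - power mu f theta2 delta.
  move=> t2; rewrite /power -{2}(density_Rintegral t2).
  rewrite -RintegralB//; [|exact: density_integrable|exact: irule].
  by apply: eq_Rintegral => y _; ring.
have := power_eq0_transfer t t' r1; rewrite !pC// p1 subrr => /(_ erefl).
lra.
Qed.

(** Weak compactness applies to countably many densities only; equicontinuity
    of the powers passes from a dense sequence of parameters to all of them. *)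
Lemma rule_seq_power_compact (delta_ : nat -> Y -> R) theta0 : Theta theta0 ->
  (forall n, decision_rule (delta_ n)) ->
  exists delta (s : nat -> nat), [/\ decision_rule delta,
    forall n, (n <= s n)%N &
    forall theta, Theta theta ->
      power mu f theta (delta_ (s n)) @[n --> \oo] --> power mu f theta delta].
Proof.
move=> t0 rd.
have [D [DT Ddense]] := compact_dense_sequence (ex_intro _ _ t0) cTheta.
have [||k|k|//|h [s [rh ns hs]]] := @rule_seq_weak_compact _ _ _ mu (f theta0)
  (fun k => f (D k)) delta_.
- by have [] := fd t0.
- exact: density_integrable.
- exact: density_integrable.
- exact: density_null_transfer.
exists h, s; split => // theta t.
have [u uD] := Ddense theta t.
apply/cvgrPdist_le => e e0; have e30 : 0 < e / 3 by lra.
have /cvgrPdist_le/(_ _ e30)[N _ /(_ N (leqnn N))/=] :=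
  L1_cvg (fun n => DT (u n)) t uD.
rewrite sub0r normrN => /(le_trans (ler_norm _)) close.
have /cvgrPdist_le/(_ _ e30) := hs (u N).
apply: filterS => n hn.
have := power_lipschitz (DT (u N)) t rh.
have := power_lipschitz (DT (u N)) t (rd (s n)).
move: hn close; rewrite -/(power mu f (D (u N)) h) -/(power mu f (D (u N)) (delta_ (s n))).
rewrite !ler_norml; lra.
Qed.

Lemma power_bounded_away delta : Theta !=set0 -> decision_rule delta ->
  (forall theta, Theta theta -> 0 < power mu f theta delta < 1) ->
  exists e : R, 0 < e /\
    forall theta, Theta theta -> e <= power mu f theta delta <= 1 - e.
Proof.
move=> T0 r p01.
have cp := power_continuous r.
have [a aT amin] := compact_EVT_min T0 cTheta cp.
have [b bT bmax] := compact_EVT_max T0 cTheta cp.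
rewrite inE in aT; rewrite inE in bT.
have /andP[a0 _] := p01 a aT; have /andP[_ b1] := p01 b bT.
exists (Num.min (power mu f a delta) (1 - power mu f b delta)); split.
  by rewrite lt_min a0 subr_gt0.
move=> theta t; have := amin theta (mem_set t); have := bmax theta (mem_set t).
move=> tb ta; rewrite ge_min ta/= lerBrDr addrC -lerBrDr ge_min.
by apply/orP; right; rewrite lerD2l lerN2.
Qed.

End L1continuity.
End Power.

(** * Existence and first-order conditions for the testing problem *)

Section Problem.
Context {R : realType} {d1 : nat} {d : measure_display} {Y : measurableType d}.
Variable mu : {sigma_finite_measure set Y -> \bar R}.
Variables (f : 'rV[R]_d1 -> Y -> R) (Theta : set 'rV[R]_d1).
Hypothesis cTheta : compact Theta.
Hypothesis fd : forall theta, Theta theta -> is_density mu (f theta).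
Hypothesis fL1 : L1_continuous_on Theta mu f.
Hypothesis fac : mutually_abs_continuous_on Theta mu f.
Variable theta0 : 'rV[R]_d1.
Hypothesis t0 : Theta theta0.
Context (Theta1 : set 'rV[R]_d1) (hTheta1 : Theta1 !=set0).
Hypothesis sTheta1 : Theta1 `<=` Theta.
Variable Lambda1 : probability (borel_of hTheta1) R.
Hypothesis mf : measurable_fun setT
  (fun z : borel_of hTheta1 * Y => f (borel_val z.1) z.2).
Variables (alpha : R) (g : R -> R).
Hypothesis alpha01 : 0 < alpha < 1.
Hypothesis mg : measurable_fun (`[0, 1] : set R) g.
Hypothesis gC1 : C1_inside_continuous_at_ends g.
Implicit Types (delta h : Y -> R) (t : borel_of hTheta1).

Local Notation T1 := (borel_of hTheta1).
Local Notation pow := (power mu f).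
Local Notation obj := (objective mu f g Lambda1).
Local Notation opt := (optimal mu f theta0 alpha g Lambda1).
Local Notation feas := (feasible mu f theta0 alpha).

Lemma borel_val_in t : Theta (borel_val t).
Proof. by apply: sTheta1; have := valP (t : set_type Theta1); rewrite inE. Qed.

Let f0 t y : 0 <= f (borel_val t) y.
Proof. by have [] := fd (borel_val_in t). Qed.

Lemma pow01 theta delta : Theta theta -> decision_rule delta ->
  0 <= pow theta delta <= 1.
Proof. by move=> t r; rewrite (power_ge0 fd)//= (power_le1 fd). Qed.

Lemma measurable_power delta : decision_rule delta ->
  measurable_fun setT (fun t => pow (borel_val t) delta).
Proof.
move=> [mdelta delta01].
pose F (z : T1 * Y) := (delta z.2 * f (borel_val z.1) z.2)%:E.
have mF : measurable_fun setT F.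
  apply/measurable_EFinP/measurable_funM => //.
  exact: measurableT_comp.
have F0 z : (0 <= F z)%E.
  by rewrite lee_fin mulr_ge0//; have /andP[] := delta01 z.2.
have mI := measurable_fun_fubini_tonelli_F (m2 := mu) F mF F0.
exact: (measurableT_comp (fine_measurable measurableT) mI).
Qed.

Lemma integrable_probability_bounded (h : T1 -> R) (M : R) :
  measurable_fun setT h -> (forall t, `|h t| <= M) ->
  Lambda1.-integrable setT (EFin \o h).
Proof.
move=> mh hM.
apply: (le_integrable measurableT (g := EFin \o cst M)).
- exact/measurable_EFinP.
- by move=> t _; rewrite lee_fin (le_trans (hM t))//= ler_norm.
- exact: finite_measure_integrable_cst.
Qed.

Lemma measurable_objective delta : decision_rule delta ->
  measurable_fun setT (fun t => g (pow (borel_val t) delta)).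
Proof.
move=> r; have g01 : [set pow (borel_val t) delta | t in [set: T1]] `<=` `[0, 1]%classic.
  by move=> _ [t _ <-] /=; rewrite in_itv/= pow01//; exact: borel_val_in.
exact: (measurable_comp (measurable_itv _) g01 mg (measurable_power r)).
Qed.

Lemma integrable_objective delta : decision_rule delta ->
  Lambda1.-integrable setT (EFin \o (fun t => g (pow (borel_val t) delta))).
Proof.
move=> r; have [M gM] := C1_bounded01 gC1.
apply: (integrable_probability_bounded (M := M)); first exact: measurable_objective.
by move=> t; apply: gM; apply: pow01 => //; exact: borel_val_in.
Qed.

Lemma Rintegral_probability_cst (c : R) : \int[Lambda1]_t c = c.
Proof.
rewrite Rintegral_cst//.
have -> : fine (Lambda1 setT) = 1 by rewrite probability_setT.
by rewrite mulr1.
Qed.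

Lemma feasible_cst (a : R) : 0 <= a <= alpha -> feas (fun=> a).
Proof.
move=> /andP[a0 aa]; split; last by rewrite (power_cst fd).
by apply: rule_cst; rewrite a0 (le_trans aa)// ltW//; case/andP: alpha01.
Qed.

Lemma optimal_exists : exists delta, opt delta.
Proof.
pose S := [set obj delta | delta in feas].
have S_sup : has_sup S.
  split; first by exists (obj (fun=> 0)), (fun=> 0) => //; apply: feasible_cst;
    rewrite lexx ltW//; case/andP: alpha01.
  have [M gM] := C1_bounded01 gC1.
  exists M => _ [delta [r _] <-].
  rewrite -[leRHS]Rintegral_probability_cst; apply: le_Rintegral => //.
  - exact: integrable_objective.
  - exact: finite_measure_integrable_cst.
  - move=> t _; apply: le_trans (ler_norm _) (gM _ _).
    by apply: pow01 => //; exact: borel_val_in.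
have step n : exists delta, feas delta /\ sup S - n.+1%:R^-1 < obj delta.
  have n0 : 0 < n.+1%:R^-1 :> R by rewrite invr_gt0.
  by have [_ [delta fdelta <-] sd] := sup_adherent n0 S_sup; exists delta.
have [delta_ /all_and2[feas_ sup_]] := choice step.
have [delta [s [r ns cvp]]] := rule_seq_power_compact fd fL1 cTheta fac t0
  (fun n => (feas_ n).1).
have cvobj : obj (delta_ (s n)) @[n --> \oo] --> obj delta.
  have [M gM] := C1_bounded01 gC1.
  apply: (@dominated_cvg_Rintegral _ _ _ Lambda1 _ _ (cst M)).
  - by move=> n; apply: measurable_objective; case: (feas_ (s n)).
  - exact: measurable_objective.
  - apply: aeW => t.
    apply: (within_continuous_seq (C1_within01 gC1)); last exact: cvp (borel_val_in t).
      by move=> n /=; rewrite in_itv/= pow01//; [exact: borel_val_in|case: (feas_ (s n))].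
    by rewrite /= in_itv/= pow01//; exact: borel_val_in.
  - exact: finite_measure_integrable_cst.
  - move=> n t; apply: gM; apply: pow01; first exact: borel_val_in.
    by case: (feas_ (s n)).
have feas_delta : feas delta.
  split=> //; apply: cvgr_to_le (cvp _ t0) _; apply: nearW => n.
  by have [] := feas_ (s n).
exists delta; split; first exact: feas_delta.
move=> delta' fdelta'.
have obj_sup : obj delta' <= sup S by apply: (ub_le_sup S_sup.2); exists delta'.
apply: le_trans obj_sup _.
have cvh : obj (delta_ (s n)) + harmonic n @[n --> \oo] --> obj delta + 0.
  by apply: cvgD => //; exact: cvg_harmonic.
rewrite -[leRHS]addr0; apply: cvgr_to_ge cvh _; apply: nearW => n.
rewrite -lerBlDr; apply: le_trans (ltW (sup_ (s n))).
by rewrite lerD2l lerN2 /harmonic/= lef_pV2 ?posrE// ler_nat ltnS.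
Qed.

(** A power equal to 1 at some parameter is 1 at [theta0], above [alpha]; a
    power equal to 0 at some parameter is 0 everywhere, and then the zero rule
    does as well as [delta]. *)
Lemma optimal_power_interior delta theta : ~ opt (fun=> 0) -> opt delta ->
  Theta theta -> 0 < pow theta delta < 1.
Proof.
move=> nopt0 [[r pa] odelta] tt; have /andP[p0 p1] := pow01 tt r.
rewrite !lt_neqAle p0 p1 !andbT; apply/andP; split; apply/eqP; last first.
  move=> pe; have := power_eq1_transfer fd fac tt t0 r pe.
  by move: pa; case/andP: alpha01; lra.
move=> pe; apply: nopt0; split.
  by apply: feasible_cst; rewrite lexx ltW//; case/andP: alpha01.
move=> delta' fdelta'; apply: le_trans (odelta _ fdelta') _.
rewrite le_eqVlt; apply/orP; left; apply/eqP; apply: eq_Rintegral => t _.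
rewrite (power_eq0_transfer fd fac tt (borel_val_in t) r) ?(power_cst fd)//.
exact: borel_val_in.
Qed.

Section InteriorRule.
Variables (delta : Y -> R) (e : R).
Hypothesis r : decision_rule delta.
Hypothesis e0 : 0 < e.
Hypothesis pow_e : forall theta, Theta theta -> e <= pow theta delta <= 1 - e.

Local Notation phi t := (derive1 g (pow (borel_val t) delta)).
Local Notation H := (weighted_density mu f g Lambda1 delta).

Lemma marginal_bounded : exists M, forall t, `|phi t| <= M.
Proof.
have e1 : 1 - e < 1 by rewrite ltrBlDr ltrDl.
have [M gM] := derive1_bounded gC1 e0 e1.
by exists M => t; apply: gM; apply: pow_e; exact: borel_val_in.
Qed.

Lemma measurable_marginal : measurable_fun setT (fun t => phi t).
Proof.
have mdg : measurable_fun (`]0, 1[%classic : set R) (derive1 g).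
  apply: open_continuous_measurable_fun; first exact: interval_open.
  by move=> x; rewrite inE/= in_itv/=; case: gC1 => _ + _ _; exact.
have sub : [set pow (borel_val t) delta | t in [set: T1]] `<=` `]0, 1[%classic.
  move=> _ [t _ <-] /=; rewrite in_itv/=.
  by have := pow_e (borel_val_in t); move: e0; lra.
exact: (measurable_comp (measurable_itv _) sub mdg (measurable_power r)).
Qed.

(** The difference quotients of the objective along the segment from [delta] to
    [delta'] are nonpositive.  The powers are away from 0 and 1, so the
    quotients are bounded by a bound on [g'] and converge under the
    integral. *)
Lemma first_order_condition delta' : opt delta -> feas delta' ->
  \int[Lambda1]_t (phi t * (pow (borel_val t) delta' - pow (borel_val t) delta)) <= 0.
Proof.
move=> [[_ pa] odelta] [r' pa']; have e_gt0 := e0.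
have e1 : e <= 2^-1 by have := pow_e t0; lra.
(* Steps of at most [e / 2] keep the powers in [[e / 2, 1 - e / 2]]. *)
pose s n : R := e / 2 * n.+1%:R^-1.
have s0 n : 0 < s n by rewrite /s mulr_gt0 ?invr_gt0// divr_gt0.
have se n : s n <= e / 2.
  apply: ler_piMr; first by rewrite divr_ge0// ltW.
  by rewrite invf_le1 ?ltr0n// ler1n.
have cvs : s n @[n --> \oo] --> 0.
  rewrite -[X in _ --> X](mulr0 (e / 2)).
  by apply: cvgM; [exact: cvg_cst|exact: cvg_harmonic].
pose p t := pow (borel_val t) delta; pose q t := pow (borel_val t) delta'.
pose D n t := (g (p t + s n * (q t - p t)) - g (p t)) / s n.
have pq t : `|q t - p t| <= 1.
  have := pow01 (borel_val_in t) r; have := pow01 (borel_val_in t) r'.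
  by rewrite ler_norml -/(p t) -/(q t); lra.
have rs n : decision_rule (fun y => delta y + s n * (delta' y - delta y)).
  by apply: rule_segment => //; rewrite ltW//= (le_trans (se n))//; lra.
have ps n t : p t + s n * (q t - p t) =
    pow (borel_val t) (fun y => delta y + s n * (delta' y - delta y)).
  by rewrite (power_segment fd) //; exact: borel_val_in.
have mD n : measurable_fun setT (D n).
  apply: measurable_funM => //; apply: measurable_funB.
    by under eq_fun do rewrite ps; exact: measurable_objective.
  exact: measurable_objective.
have fs n : feas (fun y => delta y + s n * (delta' y - delta y)).
  split=> //; rewrite (power_segment fd)//.
  have := s0 n; have := se n; move: pa pa' e1; nra.
have ID n : \int[Lambda1]_t D n t <= 0.
  rewrite RintegralZr//; last first.
    apply: integrableB_fun; last exact: integrable_objective.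
    under eq_fun do rewrite ps; exact: integrable_objective.
  rewrite pmulr_lle0 ?invr_gt0// RintegralB//; last 2 first.
  - by under eq_fun do rewrite ps; exact: integrable_objective.
  - exact: integrable_objective.
  by under eq_Rintegral do rewrite ps; rewrite subr_le0; exact: odelta (fs n).
have [M gM] := derive1_bounded gC1 (ltac:(lra) : 0 < e / 2) (ltac:(lra) : 1 - e / 2 < 1).
have mv n t : exists c, [/\ `|derive1 g c| <= M, `|c - p t| <= s n &
    D n t = derive1 g c * (q t - p t)].
  have pt := pow_e (borel_val_in t); rewrite -/(p t) in pt.
  have spq : `|s n * (q t - p t)| <= s n.
    by rewrite normrM (gtr0_norm (s0 n)) ler_piMr// ltW.
  have [||||c [cI cp gc]] := @C1_mean_value _ g gC1 (e / 2) (1 - e / 2) (p t)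
     (p t + s n * (q t - p t)).
  - lra.
  - lra.
  - lra.
  - by move: spq; rewrite ler_norml; have := se n; lra.
  exists c; split; first exact: gM.
    by apply: le_trans cp _; rewrite addrC addKr.
  by rewrite /D gc addrAC subrr add0r; field; rewrite gt_eqF.
have cvD t : D n t @[n --> \oo] --> phi t * (q t - p t).
  have [c /all_and3[_ cp cD]] := choice (fun n => mv n t).
  under eq_fun do rewrite cD.
  apply: cvgM; last exact: cvg_cst.
  have pt : 0 < p t < 1 by have := pow_e (borel_val_in t); rewrite -/(p t); lra.
  have [_ cg _ _] := gC1.
  have cc : c n @[n --> \oo] --> p t.
    apply: (@squeeze_cvgr _ _ _ _ (fun n => p t - s n) (fun n => p t + s n)).
    - by apply: nearW => n; have := cp n; rewrite ler_norml; lra.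
    - by rewrite -[X in _ --> X]subr0; apply: cvgB => //; exact: cvg_cst.
    - by rewrite -[X in _ --> X]addr0; apply: cvgD => //; exact: cvg_cst.
  exact: (cvg_comp _ _ cc (cg _ pt)).
have mlim : measurable_fun setT (fun t => phi t * (q t - p t)).
  apply: measurable_funM; first exact: measurable_marginal.
  by apply: measurable_funB; exact: measurable_power.
have /cvgr_to_le : \int[Lambda1]_t D n t @[n --> \oo] -->
    \int[Lambda1]_t (phi t * (q t - p t)).
  apply: (@dominated_cvg_Rintegral _ _ _ Lambda1 _ _ (cst M)) => //.
  - exact: aeW.
  - exact: finite_measure_integrable_cst.
  - move=> n t; have [c [cM _ ->]] := mv n t.
    by rewrite normrM (le_trans _ cM)// ler_piMr.
by apply; exact: nearW.
Qed.

Let K (z : Y * T1) : R := phi z.2 * f (borel_val z.2) z.1.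

Lemma integrable_marginal_density : (mu \x Lambda1)%E.-integrable setT (EFin \o K).
Proof.
have mK : measurable_fun setT (EFin \o K).
  apply/measurable_EFinP/measurable_funM.
    exact: (measurableT_comp measurable_marginal measurable_snd).
  exact: (measurableT_comp mf (measurable_fun_pair measurable_snd measurable_fst)).
apply/(integrable21ltyP mu Lambda1 mK).
have [M phiM] := marginal_bounded.
apply: (@le_lt_trans _ _ (\int[Lambda1]_t (cst M t)%:E)%E); last first.
  by apply: integrable_lty => //; exact: finite_measure_integrable_cst.
apply: ge0_le_integral => //.
- by move=> t _; apply: integral_ge0.
- apply: (measurable_fun_fubini_tonelli_G (m1 := mu) (fun z => `|(EFin \o K) z|%E)) => //.
  exact: measurableT_comp.
- exact/measurable_EFinP.
- move=> t _.
  under eq_integral do rewrite /K/= normrM (ger0_norm (f0 _ _)) EFinM.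
  rewrite ge0_integralZl//.
  + have [_ _ ->] := fd (borel_val_in t).
    by rewrite mule1 lee_fin.
  + by have [mft _ _] := fd (borel_val_in t); exact/measurable_EFinP.
  + by move=> y _; rewrite lee_fin.
Qed.

Lemma integrable_weighted_density : mu.-integrable setT H.
Proof. exact: (integrable_fubini_F integrable_marginal_density). Qed.

Lemma weighted_density_ae_fin : {ae mu, forall y, H y = (fine (H y))%:E}.
Proof.
have := integrable_ae measurableT integrable_weighted_density.
by apply: filterS => y /(_ I) Hy; rewrite fineK.
Qed.

Lemma integrable_fine_weighted_density :
  mu.-integrable setT (EFin \o (fun y => fine (H y))).
Proof.
have mH := measurable_int mu integrable_weighted_density.
apply/integrableP; split.
  apply/measurable_EFinP.
  exact: (measurableT_comp (fine_measurable measurableT) mH).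
have /integrableP[_] := integrable_weighted_density.
apply: le_lt_trans; apply: ge0_le_integral => //.
- apply: measurableT_comp => //; apply/measurable_EFinP.
  exact: (measurableT_comp (fine_measurable measurableT) mH).
- exact: measurableT_comp.
- by move=> y _ /=; case: (H y) => //=; rewrite normr0 leey.
Qed.

(** Fubini's theorem.  The inner integral over the parameters is finite for
    almost every observation only, hence the [fine] on the right. *)
Lemma weighted_density_duality h : decision_rule h ->
  \int[Lambda1]_t (phi t * pow (borel_val t) h) = \int[mu]_y (h y * fine (H y)).
Proof.
move=> rh.
pose L (z : Y * T1) := h z.1 * K z.
have iL : (mu \x Lambda1)%E.-integrable setT (EFin \o L).
  have mK := measurable_int (mu \x Lambda1)%E integrable_marginal_density.
  apply: (le_integrable measurableT _ _ integrable_marginal_density).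
    apply/measurable_EFinP/measurable_funM; last exact/measurable_EFinP.
    by apply: (measurableT_comp _ measurable_fst) => //; case: rh.
  move=> z _; rewrite /= lee_fin normrM ler_piMl//.
  by have /andP[? ?] := rh.2 z.1; rewrite ger0_norm.
have := Fubini iL.
rewrite -/(Rintegral _ _ _) /=.
have -> : (\int[Lambda1]_t \int[mu]_y (L (y, t))%:E =
    \int[Lambda1]_t (phi t * pow (borel_val t) h)%:E)%E.
  apply: eq_integral => t _.
  rewrite /L /K/=; under eq_integral => y _ do rewrite mulrCA EFinM.
  have ih := integrable_rule_mul rh (density_integrable fd (borel_val_in t)).
  rewrite integralZl// EFinM; congr (_ * _)%E.
  by rewrite fineK//; exact: integrable_fin_num.
have -> : (\int[mu]_y \int[Lambda1]_t (L (y, t))%:E =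
    \int[mu]_y (h y * fine (H y))%:E)%E.
  apply: ae_eq_integral => //.
  - exact: measurable_int (integrable_fubini_F iL).
  - apply: measurable_int; exact: integrable_rule_mul rh integrable_fine_weighted_density.
  - apply: filterS2 (ae_integrable1 integrable_marginal_density)
      weighted_density_ae_fin => y iKy Hy _.
    rewrite EFinM -Hy -integralZl//.
by rewrite /Rintegral => ->.
Qed.

End InteriorRule.

Lemma optimal_power_away delta : ~ opt (fun=> 0) -> opt delta ->
  exists e : R, 0 < e /\
    forall theta, Theta theta -> e <= pow theta delta <= 1 - e.
Proof.
move=> nopt0 odelta; have [[r _] _] := odelta.
apply: (power_bounded_away fd fL1 cTheta _ r); first by exists theta0.
by move=> theta; exact: optimal_power_interior.
Qed.

(** Among the rules with the same power at [theta0], all feasible, the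
    first-order condition makes [delta] a maximizer of a linear functional.
    The rule itself serves as the randomization where equality holds. *)
Lemma optimal_neyman_pearson delta : ~ opt (fun=> 0) -> opt delta ->
  exists kappa, {ae mu, forall y,
    neyman_pearson_at mu f theta0 g Lambda1 delta kappa delta y}.
Proof.
move=> nopt0 odelta; have [[r pa] _] := odelta.
have [e [e0 pe]] := optimal_power_away nopt0 odelta.
have p01 := optimal_power_interior nopt0 odelta t0.
move=> {nopt0}; have [_ f00 _] := fd t0.
have [||kappa kP] := neyman_pearson_threshold f00 (density_integrable fd t0)
  (integrable_fine_weighted_density r e0 pe) r.
- move=> delta' r' pp'.
  have fdelta' : feas delta' by split => //; rewrite /power pp'.
  have := first_order_condition r e0 pe odelta fdelta'.
  under eq_Rintegral do rewrite mulrBr.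
  have ip h : decision_rule h -> Lambda1.-integrable setT (EFin \o
      (fun t => derive1 g (pow (borel_val t) delta) * pow (borel_val t) h)).
    move=> rh; have [M phiM] := marginal_bounded e0 pe.
    apply: (integrable_probability_bounded (M := M)).
      apply: measurable_funM; first exact: (measurable_marginal r e0 pe).
      exact: measurable_power.
    move=> t; have /andP[p0 p1] := pow01 (borel_val_in t) rh.
    apply: le_trans (phiM t); rewrite normrM; apply: ler_piMr => //.
    by rewrite ger0_norm.
  rewrite (RintegralB measurableT (ip _ r') (ip _ r)).
  by rewrite subr_le0 (weighted_density_duality r e0 pe r')
    (weighted_density_duality r e0 pe r).
- by rewrite (density_Rintegral fd t0).
exists kappa.
apply: filterS2 kP (weighted_density_ae_fin r e0 pe) => y [k1 k0] HE.
by rewrite /neyman_pearson_at HE; split; rewrite ?lte_fin.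
Qed.

(** An optimal rule is redefined by its own Neyman-Pearson form.  The change is
    on a null set, so the powers, and with them the weighted density that
    enters the form, stay the same. *)
Lemma optimal_neyman_pearson_everywhere : ~ opt (fun=> 0) ->
  exists delta, opt delta /\ exists kappa gamma, decision_rule gamma /\
    forall y, neyman_pearson_at mu f theta0 g Lambda1 delta kappa gamma y.
Proof.
move=> nopt0; have [gamma ogamma] := optimal_exists.
have [[r pa] omax] := ogamma.
have [e [e0 pe]] := optimal_power_away nopt0 ogamma.
have [kappa npk] := optimal_neyman_pearson nopt0 ogamma.
move=> {nopt0}.
pose H y := weighted_density mu f g Lambda1 gamma y.
have mH : measurable_fun setT H := measurable_int mu (integrable_weighted_density r e0 pe).
have mk : measurable_fun setT (fun y => (kappa * f theta0 y)%:E).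
  by apply/measurable_EFinP/measurable_funM => //; have [] := fd t0.
pose A := [set y | ((kappa * f theta0 y)%:E < H y)%E].
pose B := [set y | (H y < (kappa * f theta0 y)%:E)%E].
have mA : measurable A by rewrite -[A]setTI; exact: measurable_lte.
have mB : measurable B by rewrite -[B]setTI; exact: measurable_lte.
pose delta y : R := \1_A y + gamma y * ((1 - \1_A y) * (1 - \1_B y)).
have deltaA y : A y -> delta y = 1.
  by move=> Ay; rewrite /delta !indicE mem_set//= subrr mul0r mulr0 addr0.
have deltaB y : B y -> delta y = 0.
  move=> By; rewrite /delta !indicE (mem_set By) memNset/=.
    by rewrite subrr !mulr0 addr0.
  by move=> Ay; have := lt_trans Ay By; rewrite ltxx.
have deltaAB y : ~ A y -> ~ B y -> delta y = gamma y.
  by move=> Ay By; rewrite /delta !indicE !memNset//= subr0 !mulr1 add0r.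
have rdelta : decision_rule delta.
  split.
    apply: measurable_funD => //; apply: measurable_funM; first by case: r.
    by apply: measurable_funM; apply: measurable_funB.
  move=> y; have [Ay|Ay] := pselect (A y); first by rewrite deltaA// ler01 lexx.
  have [By|By] := pselect (B y); first by rewrite deltaB// ler01 lexx.
  by rewrite deltaAB//; case: r.
have ae_eq : {ae mu, forall y, delta y = gamma y}.
  apply: filterS npk => y [k1 _ k0].
  have [Ay|Ay] := pselect (A y); first by rewrite deltaA// k1.
  have [By|By] := pselect (B y); first by rewrite deltaB// k0.
  exact: deltaAB.
have peq theta : Theta theta -> pow theta delta = pow theta gamma.
  by move=> tt; exact: (power_ae_eq fd).
exists delta; split.
  split; first by split => //; rewrite peq.
  move=> delta' /omax /le_trans; apply.
  rewrite le_eqVlt; apply/orP; left; apply/eqP/eq_Rintegral => t _.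
  by rewrite (peq _ (borel_val_in t)).
exists kappa, gamma; split => // y.
have HE : weighted_density mu f g Lambda1 delta y = H y.
  by apply: eq_integral => t _; rewrite peq//; exact: borel_val_in.
split; rewrite HE.
- exact: deltaA.
- by move=> Hk; apply: deltaAB; rewrite /A/B/= Hk ltxx.
- exact: deltaB.
Qed.

Section IncreasingUtility.
Hypothesis dg0 : forall s, 0 < s < 1 -> 0 < derive1 g s.

Lemma zero_rule_not_optimal : ~ opt (fun=> 0).
Proof.
have obj_cst (a : R) : obj (fun=> a) = g a.
  rewrite -[RHS]Rintegral_probability_cst; apply: eq_Rintegral => t _.
  by rewrite (power_cst fd _ (borel_val_in t)).
have /andP[a0 a1] := alpha01.
have fa : feas (fun=> alpha) by apply: feasible_cst; rewrite lexx ltW.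
move=> [_ /(_ _ fa)]; rewrite !obj_cst leNgt => /negP; apply.
by apply: (C1_increasing01 gC1 dg0) => //; exact: ltW.
Qed.

(** With slack in the constraint, a step towards the constant rule 1 remains
    feasible and strictly increases every power, since no power equals 1. *)
Lemma optimal_power_binding delta : opt delta -> pow theta0 delta = alpha.
Proof.
move=> odelta; have [[r pa] omax] := odelta.
apply/eqP; rewrite eq_le pa/= leNgt; apply/negP => pa'.
have p01 := optimal_power_interior zero_rule_not_optimal odelta.
pose s := alpha - pow theta0 delta.
have s01 : 0 < s < 1.
  by have := p01 _ t0; move: pa'; case/andP: alpha01; rewrite /s; lra.
have s01' : 0 <= s <= 1 by case/andP: s01 => ? ?; rewrite !ltW.
have r1 : decision_rule (fun _ : Y => 1 : R) by apply: rule_cst; rewrite ler01 lexx.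
pose delta' y := delta y + s * (1 - delta y).
have rdelta' : decision_rule delta' by exact: rule_segment s01' r r1.
have pE theta : Theta theta -> pow theta delta' =
    pow theta delta + s * (1 - pow theta delta).
  by move=> tt; rewrite /delta' (power_segment fd)// (power_cst fd).
have fdelta' : feas delta'.
  split => //; rewrite pE//; have := p01 _ t0; rewrite /s; nra.
have gt t : g (pow (borel_val t) delta) < g (pow (borel_val t) delta').
  have /andP[p0 p1] := p01 _ (borel_val_in t).
  have /andP[_ p'1] := pow01 (borel_val_in t) rdelta'.
  apply: (C1_increasing01 gC1 dg0) => //; first exact: ltW.
  rewrite (pE _ (borel_val_in t)) ltrDl.
  by apply: mulr_gt0; [case/andP: s01|rewrite subr_gt0].
have := omax _ fdelta'; rewrite leNgt => /negP; apply.
rewrite -subr_gt0 /objective -RintegralB//; [|exact: integrable_objective..].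
apply: Rintegral_gt0.
- by apply: integrableB_fun; exact: integrable_objective.
- by move=> t; rewrite subr_ge0 ltW.
- move=> [N [mN N0 sN]].
  have NT : N = setT.
    apply/seteqP; split => // t _; apply: sN => /= /eqP.
    by rewrite subr_eq0 gt_eqF.
  have : (1 = 0 :> \bar R)%E by rewrite -(probability_setT Lambda1) -NT; exact: N0.
  by move/eqP; rewrite onee_eq0.
Qed.

End IncreasingUtility.

End Problem.

(** * Inclusions between Borel subspaces *)

Section BorelInclusion.
Context {R : realType} {n : nat} (A B : set 'rV[R]_n).
Variables (hA : A !=set0) (hB : B !=set0) (AB : A `<=` B).

(** The joint measurability of the densities is over [Theta], the prior over
    [Theta1]; this map restricts the former to the latter. *)
Definition borel_inclusion (x : borel_of hA) : borel_of hB :=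
  exist (fun x => x \in B) (borel_val x)
    (mem_set (AB (set_mem (valP (x : set_type A))))).

Lemma measurable_borel_inclusion : measurable_fun setT borel_inclusion.
Proof.
apply: (@measurability _ _ (borel_of hA) (borel_of hB) setT borel_inclusion
  (@open (subspace_of hB)) erefl).
move=> _ [U [V oV <-] <-].
rewrite setTI; apply: sub_sigma_algebra.
by exists V.
Qed.

End BorelInclusion.

(** * Optimal tests and their Neyman-Pearson form *)

Theorem theorem5 (R : realType) (d1 d2 : nat)
  (hd1 : (1 <= d1)%N) (hd2 : (1 <= d2)%N)
  (Theta : set 'rV[R]_d1) (cTheta : compact Theta)
  (theta0 : 'rV[R]_d1) (hTheta0 : Theta theta0)
  (hTheta1 : Theta `\ theta0 !=set0)
  (Y : set 'rV[R]_d2) (hY : Y !=set0)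
  (mu : {sigma_finite_measure set (borel_of hY) -> \bar R})
  (f : 'rV[R]_d1 -> borel_of hY -> R)
  (f_density : forall theta, Theta theta -> is_density mu (f theta))
  (f_measurable : measurable_fun setT
    (fun z : borel_of (ex_intro Theta theta0 hTheta0) * borel_of hY =>
       f (borel_val z.1) z.2))
  (alpha : R) (halpha : 0 < alpha < 1)
  (g : R -> R) (g_measurable : measurable_fun (`[0, 1] : set R) g)
  (Lambda1 : probability (borel_of hTheta1) R)
  (A1_cont : L1_continuous_on Theta mu f)
  (A1_abs : mutually_abs_continuous_on Theta mu f)
  (A2 : C1_inside_continuous_at_ends g) :
  [/\ ~ optimal mu f theta0 alpha g Lambda1 (fun=> 0) ->
      exists delta, optimal mu f theta0 alpha g Lambda1 delta /\
        exists (kappa : R) (gamma : borel_of hY -> R),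
          decision_rule gamma /\
          forall y, neyman_pearson_at mu f theta0 g Lambda1 delta kappa gamma y,
      ~ optimal mu f theta0 alpha g Lambda1 (fun=> 0) ->
      forall delta, optimal mu f theta0 alpha g Lambda1 delta ->
        exists (kappa : R) (gamma : borel_of hY -> R),
          decision_rule gamma /\
          {ae mu, forall y,
            neyman_pearson_at mu f theta0 g Lambda1 delta kappa gamma y} &
      (forall t, 0 < t < 1 -> 0 < derive1 g t) ->
      ~ optimal mu f theta0 alpha g Lambda1 (fun=> 0) /\
      forall delta, optimal mu f theta0 alpha g Lambda1 delta ->
        power mu f theta0 delta = alpha].
Proof.
have sub : Theta `\ theta0 `<=` Theta by move=> x [].
have mincl : measurable_fun setT (fun z : borel_of hTheta1 * borel_of hY =>
    (borel_inclusion (ex_intro Theta theta0 hTheta0) sub z.1, z.2)).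
  apply: measurable_fun_pair; last exact: measurable_snd.
  exact: (measurableT_comp 
    (@measurable_borel_inclusion _ _ _ _ hTheta1 (ex_intro Theta theta0 hTheta0) sub)
    measurable_fst).
have mf1 : measurable_fun setT (fun z : borel_of hTheta1 * borel_of hY =>
    f (borel_val z.1) z.2) := measurableT_comp f_measurable mincl.
split.
- exact: (optimal_neyman_pearson_everywhere cTheta f_density A1_cont A1_abs hTheta0 sub mf1).
- move=> nopt delta odelta.
  have [kappa npk] := optimal_neyman_pearson cTheta f_density A1_cont A1_abs hTheta0 sub
    mf1 halpha g_measurable A2 nopt odelta.
  by exists kappa, delta; split => //; case: odelta => -[].
- move=> dg0; split.
    exact: (zero_rule_not_optimal f_density hTheta0 sub halpha A2 dg0).
  by move=> delta; 
    exact: (optimal_power_binding f_density A1_abs hTheta0 sub mf1 halpha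
      g_measurable A2 dg0).
Qed.
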